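(* For $G$ a locally compact group, the convolution mapping $\beta\colon L^1_c(G)\times L^1_c(G)\to L^1_c(G)$, $(\gamma,\eta)\mapsto\gamma*\eta$ is continuous if and only if $G$ is $\sigma$-compact.
   Context: Locally compact groups are Hausdorff. $\lambda_G$ is a left Haar measure on $G$, i.e. a non-zero left invariant Radon measure, where a Radon measure is a positive Borel measure, finite on compact sets, with $\lambda_G(A)=\sup\{\lambda_G(K)\colon K\subseteq A\text{ compact}\}$ for all Borel sets $A$. $(L^1(G),\|\cdot\|_{L^1})$ is the usual Lebesgue space with respect to $\lambda_G$. For compact $K\subseteq G$, $L^1_K(G)$ is the set of all $[\gamma]\in L^1(G)$ vanishing $\lambda_G$-almost everywhere outside $K$, with the topology induced by $L^1(G)$; $L^1_c(G):=\bigcup_K L^1_K(G)$ ($K$ ranging over compact subsets of $G$) carries the locally convex direct limit topology. Convolution is the usual one, $(\gamma*\eta)(x)=\int_G\gamma(y)\eta(y^{-1}x)\,d\lambda_G(y)$ for $\lambda_G$-almost every $x$. *)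

(* Defs.v *)
From HB Require Import structures.
From mathcomp Require Import all_boot all_order all_algebra.
From mathcomp Require Import all_classical all_reals all_analysis.
From mathcomp Require Import measurable_realfun.
From mathcomp Require Import ring lra.

Set Implicit Arguments.
Unset Strict Implicit.
Unset Printing Implicit Defensive.

Import Order.TTheory GRing.Theory Num.Theory.
Import numFieldNormedType.Exports.

Local Open Scope classical_set_scope.
Local Open Scope ring_scope.

(* MathComp-Analysis 1.16 provides the type [LspaceType1 mu] of a.e.-classes of
   integrable real functions without its vector space structure and norm; they
   are supplied here, first on classes of measurable functions. *)
Section ae_lmod.
Context d (T : measurableType d) (R : realType).
Variable mu : {measure set T -> \bar R}.
Local Notation L0 := {mfun_ mu, T >-> measurableTypeR R}.
Implicit Types (f g h : L0) (u v : T -> R) (a : R).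

Definition ae_class u (mu_ : measurable_fun setT u) : L0 :=
  (\pi_L0 (@mfun_Sub _ _ T (measurableTypeR R) u (mem_set mu_)))%qT.

Lemma measurable_ae f : measurable_fun setT (f : T -> R).
Proof. by have := @measurable_funPT _ _ _ _ (repr f). Qed.

Lemma ae_inj f g : (\forall x \ae mu, f x = g x) -> f = g.
Proof.
move=> fg; rewrite -(reprK f) -(reprK g); apply/eqmodP/asboolP.
by apply: filterS fg => x + _.
Qed.

Lemma ae_classE u (mu_ : measurable_fun setT u) :
  \forall x \ae mu, ae_class mu_ x = u x.
Proof.
have /eqmodP/asboolP := reprK (ae_class mu_).
by apply: filterS => x /(_ I).
Qed.

Definition ae_add f g : L0 :=
  ae_class (measurable_funD (measurable_ae f) (measurable_ae g)).
Definition ae_zero : L0 := ae_class (@measurable_cst _ _ T R setT 0).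
Definition ae_opp f : L0 := ae_class (measurable_funN (measurable_ae f)).
Definition ae_scale a f : L0 :=
  ae_class (measurable_funM (@measurable_cst _ _ T R setT a) (measurable_ae f)).

Fact ae_addA : associative ae_add.
Proof.
move=> f g h; apply: ae_inj; near=> x.
have -> : ae_add f (ae_add g h) x = f x + ae_add g h x.
  by near: x; exact: ae_classE.
have -> : ae_add g h x = g x + h x by near: x; exact: ae_classE.
have -> : ae_add (ae_add f g) h x = ae_add f g x + h x.
  by near: x; exact: ae_classE.
have -> : ae_add f g x = f x + g x by near: x; exact: ae_classE.
exact: addrA.
Unshelve. all: by end_near. Qed.

Fact ae_addC : commutative ae_add.
Proof.
move=> f g; apply: ae_inj; near=> x.
have -> : ae_add f g x = f x + g x by near: x; exact: ae_classE.
have -> : ae_add g f x = g x + f x by near: x; exact: ae_classE.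
exact: addrC.
Unshelve. all: by end_near. Qed.

Fact ae_add0 : left_id ae_zero ae_add.
Proof.
move=> f; apply: ae_inj; near=> x.
have -> : ae_add ae_zero f x = ae_zero x + f x by near: x; exact: ae_classE.
have -> : ae_zero x = 0 by near: x; exact: ae_classE.
exact: add0r.
Unshelve. all: by end_near. Qed.

Fact ae_addN : left_inverse ae_zero ae_opp ae_add.
Proof.
move=> f; apply: ae_inj; near=> x.
have -> : ae_add (ae_opp f) f x = ae_opp f x + f x by near: x; exact: ae_classE.
have -> : ae_zero x = 0 by near: x; exact: ae_classE.
have -> : ae_opp f x = - f x by near: x; exact: ae_classE.
exact: addNr.
Unshelve. all: by end_near. Qed.

HB.instance Definition _ :=
  GRing.isZmodule.Build L0 ae_addA ae_addC ae_add0 ae_addN.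

Lemma ae_addE f g : \forall x \ae mu, (f + g : L0) x = f x + g x.
Proof. exact: ae_classE. Qed.
Lemma ae_zeroE : \forall x \ae mu, (0 : L0) x = 0.
Proof. exact: ae_classE. Qed.

Let scaleE a f : \forall x \ae mu, ae_scale a f x = a * f x.
Proof. exact: ae_classE. Qed.

Fact ae_scaleA a b f : ae_scale a (ae_scale b f) = ae_scale (a * b) f.
Proof.
apply: ae_inj; near=> x.
have -> : ae_scale a (ae_scale b f) x = a * ae_scale b f x.
  by near: x; exact: scaleE.
have -> : ae_scale b f x = b * f x by near: x; exact: scaleE.
have -> : ae_scale (a * b) f x = a * b * f x by near: x; exact: scaleE.
exact: mulrA.
Unshelve. all: by end_near. Qed.

Fact ae_scale1 : left_id 1 ae_scale.
Proof.
move=> f; apply: ae_inj; near=> x.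
have -> : ae_scale 1 f x = 1 * f x by near: x; exact: scaleE.
exact: mul1r.
Unshelve. all: by end_near. Qed.

Fact ae_scaleDr : right_distributive ae_scale +%R.
Proof.
move=> a f g; apply: ae_inj; near=> x.
have -> : ae_scale a (f + g : L0) x = a * (f + g : L0) x.
  by near: x; exact: scaleE.
have -> : (f + g : L0) x = f x + g x by near: x; exact: ae_addE.
have -> : (ae_scale a f + ae_scale a g : L0) x =
    ae_scale a f x + ae_scale a g x.
  by near: x; exact: ae_addE.
have -> : ae_scale a f x = a * f x by near: x; exact: scaleE.
have -> : ae_scale a g x = a * g x by near: x; exact: scaleE.
exact: mulrDr.
Unshelve. all: by end_near. Qed.

Fact ae_scaleDl f : {morph ae_scale^~ f : a b / a + b}.
Proof.
move=> a b; apply: ae_inj; near=> x.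
have -> : ae_scale (a + b) f x = (a + b) * f x by near: x; exact: scaleE.
have -> : (ae_scale a f + ae_scale b f : L0) x =
    ae_scale a f x + ae_scale b f x.
  by near: x; exact: ae_addE.
have -> : ae_scale a f x = a * f x by near: x; exact: scaleE.
have -> : ae_scale b f x = b * f x by near: x; exact: scaleE.
exact: mulrDl.
Unshelve. all: by end_near. Qed.

HB.instance Definition _ :=
  GRing.Zmodule_isLmodule.Build R L0 ae_scaleA ae_scale1 ae_scaleDr ae_scaleDl.

Lemma ae_scaleE a f : \forall x \ae mu, (a *: f : L0) x = a * f x.
Proof. exact: ae_classE. Qed.

End ae_lmod.

Section L1.
Context d (T : measurableType d) (R : realType).
Variable mu : {measure set T -> \bar R}.
Local Notation L0 := {mfun_ mu, T >-> measurableTypeR R}.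
Local Notation L1 := (LspaceType1 mu).

(* [LspaceType1 mu] consists of the classes satisfying this predicate. *)
Definition finL1 : {pred L0} := fun f => `[< finite_norm mu 1 (f : T -> R) >].

Fact L1_subP (f : L1) : (f : L0) \in finL1.
Proof. by apply/asboolP; exact: (@Lebesgue_finite _ _ _ _ _ _ f). Qed.

Section Sub.
Context (f : L0) (fP : f \in finL1).
#[local] HB.instance Definition _ :=
  @isFinLebesgue.Build d T R mu 1%E (lexx _) f (asboolW fP).
Definition L1_Sub : L1 := f.
End Sub.

Lemma L1_rect (P : L1 -> Type) :
  (forall f (fP : f \in finL1), P (L1_Sub fP)) -> forall f, P f.
Proof.
move=> Psub [f [[f1]]].
have fP : f \in finL1 by exact/asboolP.
have -> : f1 = asboolW fP by exact: Prop_irrelevance.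
exact: Psub.
Qed.

Lemma L1_SubK f (fP : f \in finL1) : L1_Sub fP = f :> L0.
Proof. by []. Qed.

HB.instance Definition _ := isSub.Build _ _ L1 L1_rect L1_SubK.
HB.instance Definition _ := [Choice of L1 by <:].

Local Notation N1 u := ('N[mu]_1[EFin \o (u : T -> R)])%E.

Let N1_ae u v : measurable_fun setT u -> measurable_fun setT v ->
  (\forall x \ae mu, u x = v x) -> N1 u = N1 v.
Proof.
move=> mu_ mv uv; rewrite !Lnorm1; apply: ge0_ae_eq_integral => //.
- by apply: measurableT_comp => //; exact/measurable_EFinP.
- by apply: measurableT_comp => //; exact/measurable_EFinP.
- by apply: filterS uv => x /= -> _.
Qed.

Let N1D (f g : L0) : (N1 (f + g : L0)%R <= N1 f + N1 g)%E.
Proof.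
rewrite (@N1_ae _ (f \+ g)); last 1 first.
- exact: ae_addE.
- by apply: eminkowski => //; exact: measurable_ae.
- exact: measurable_ae.
- by apply: measurable_funD; exact: measurable_ae.
Qed.

Let N1Z a (f : L0) : (N1 (a *: f : L0)%R = `|a|%:E * N1 f)%E.
Proof.
rewrite (@N1_ae _ (fun x => a * f x)).
- rewrite !Lnorm1 -ge0_integralZl//.
    by apply: eq_integral => x _ /=; rewrite normrM.
  by apply: measurableT_comp => //; exact/measurable_EFinP/measurable_ae.
- exact: measurable_ae.
- by apply: measurable_funM => //; exact: measurable_ae.
- exact: ae_scaleE.
Qed.

Let N1_0 : N1 (0%R : L0) = 0%E.
Proof. by rewrite -(scale0r (0 : L0)) N1Z normr0 mul0e. Qed.

Fact finL1_submod_closed : submod_closed finL1.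
Proof.
split=> [|a f g /asboolP fin_f /asboolP fin_g]; apply/asboolP.
  by rewrite /finite_norm N1_0.
rewrite /finite_norm (le_lt_trans (N1D _ _))// lte_add_pinfty// N1Z.
by rewrite lte_mul_pinfty// lee_fin.
Qed.
HB.instance Definition _ :=
  GRing.isSubmodClosed.Build _ _ finL1 finL1_submod_closed.
HB.instance Definition _ := [SubChoice_isSubLmodule of L1 by <:].

Definition L1norm (f : L1) : R := fine ('N[mu]_1[EFin \o f])%E.

Lemma L1normE (f : L1) : (L1norm f)%:E = N1 f.
Proof.
rewrite /L1norm fineK// fin_numElt (lt_le_trans ltNy0) ?Lnorm_ge0//=.
exact/asboolP/L1_subP.
Qed.

Fact L1normD f g : L1norm (f + g) <= L1norm f + L1norm g.
Proof. by rewrite -lee_fin EFinD !L1normE; exact: N1D. Qed.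

Fact L1normZ a f : L1norm (a *: f) = `|a| * L1norm f.
Proof. by apply: EFin_inj; rewrite EFinM !L1normE; exact: N1Z. Qed.

Fact L1norm_eq0 f : L1norm f = 0 -> f = 0.
Proof.
move=> f0; apply: val_inj; apply: ae_inj.
have mf : measurable_fun setT (EFin \o f).
  exact/measurable_EFinP/measurable_ae.
have := @Lnorm_eq0_eq0 _ _ _ mu _ _ mf lte01; rewrite -L1normE f0 => /(_ erefl).
by apply: filterS2 (ae_zeroE mu) => x -> /(_ I) [].
Qed.

HB.instance Definition _ :=
  @Lmodule_isNormed.Build R L1 L1norm L1normD L1normZ L1norm_eq0.
End L1.

HB.mixin Record isTopologicalGroup G & Topological G & Group G := {
  mulg_continuous : continuous (fun p : G * G => (p.1 * p.2)%g);
  invg_continuous : continuous (fun x : G => (x^-1)%g)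
}.

(* The distinguished point is irrelevant; measurable types must be pointed. *)
#[short(type="topologicalGroupType")]
HB.structure Definition TopologicalGroup :=
  {G of PointedTopological G & Group G & isTopologicalGroup G}.

Definition borel (X : ptopologicalType) := g_sigma_algebraType (@open X).

Section L1c.
Context (R : realType) (X : ptopologicalType).
Variable mu : {measure set (borel X) -> \bar R}.
Local Notation L0 := {mfun_ mu, borel X >-> measurableTypeR R}.
Local Notation L1 := (LspaceType1 mu).
Implicit Types (K : set X) (a b c t : R).

Definition L1K K : set L1 :=
  [set f : L1 | {ae mu, forall x : borel X, ~ K x -> f x = 0}].

Definition L1c_pred : {pred L1} :=
  fun f => `[< exists2 K, compact K & L1K K f >].

Identity Coercion LspaceType1_type : LspaceType1 >-> LebesgueSpace.type.
Record L1c := MkL1c { L1c_val :> L1; L1c_valP : L1c_val \in L1c_pred }.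

HB.instance Definition _ := [isSub for L1c_val].
HB.instance Definition _ := [Choice of L1c by <:].

Lemma L1K0 K : L1K K 0.
Proof. by apply: filterS (ae_zeroE mu) => x. Qed.

Lemma L1KD K f g : L1K K f -> L1K K g -> L1K K (f + g).
Proof.
move=> fK gK; rewrite /L1K/=; near=> x => Kx.
rewrite (_ : _ x = (f : L0) x + (g : L0) x); last by near: x; exact: ae_addE.
have -> : f x = 0 by move: Kx; near: x; exact: fK.
by rewrite add0r; move: Kx; near: x; exact: gK.
Unshelve. all: by end_near. Qed.

Lemma L1KZ K a f : L1K K f -> L1K K (a *: f).
Proof.
move=> fK; rewrite /L1K/=; near=> x => Kx.
rewrite (_ : _ x = a * (f : L0) x); last by near: x; exact: ae_scaleE.
rewrite (_ : f x = 0) ?mulr0//; move: Kx; near: x; exact: fK.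
Unshelve. all: by end_near. Qed.

Lemma L1KB K f g : L1K K f -> L1K K g -> L1K K (f - g).
Proof. by move=> fK gK; rewrite -scaleN1r; apply: L1KD => //; exact: L1KZ. Qed.

Fact L1c_submod_closed : submod_closed L1c_pred.
Proof.
split=> [|a f g /asboolP[K cK Kf] /asboolP[K' cK' Kg]]; apply/asboolP.
  by exists set0; [exact: compact0|exact: L1K0].
exists (K `|` K'); first exact: compactU.
by apply: L1KD; [apply: L1KZ|]; [apply: filterS Kf|apply: filterS Kg];
  move=> x xK xKK; apply: xK => ?; apply: xKK; [left|right].
Qed.
HB.instance Definition _ :=
  GRing.isSubmodClosed.Build _ _ L1c_pred L1c_submod_closed.
HB.instance Definition _ := [SubChoice_isSubLmodule of L1c by <:].

Let valZ a (f : L1c) : L1c_val (a *: f) = a *: L1c_val f.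
Proof. by rewrite -[LHS]/(\val (a *: f)) linearZ. Qed.

Let valD (f g : L1c) : L1c_val (f + g) = L1c_val f + L1c_val g.
Proof. by rewrite -[LHS]/(\val (f + g)) raddfD. Qed.

Let val0 : L1c_val 0 = 0.
Proof. by rewrite -[LHS]/(\val (0 : L1c)) raddf0. Qed.

(* The locally convex direct limit topology: a convex set is a neighbourhood of
   0 iff its trace on each L^1_K is one for the L^1-norm topology of L^1_K.
   [lcdlimP] below is its universal property. *)
Definition lcdlim_nbhs0 : set_system L1c := [set U : set L1c | convex_set U /\
  forall K, compact K -> \forall f \near within (L1K K) (nbhs (0 : L1)),
    (L1c_val @` U) f].

Definition lcdlim_nbhs (x : L1c) : set_system L1c :=
  [set A | exists2 U, lcdlim_nbhs0 U & forall u, U u -> A (x + u)].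

HB.instance Definition _ := hasNbhs.Build L1c lcdlim_nbhs.

Let convexE (U : set L1c) : convex_set U <->
  forall x y t, 0 <= t -> t <= 1 -> U x -> U y -> U (t *: x + (1 - t) *: y).
Proof.
split=> [cU x y t t0 t1 Ux Uy|cU x y t].
  by have := cU x y (Itv01 t0 t1); rewrite !inE; exact.
by rewrite !inE; apply: cU.
Qed.

Let B := lcdlim_nbhs0.

Let B_0 U : B U -> U 0.
Proof.
move=> [_ nU]; have /nbhs_singleton/(_ (L1K0 _))[u Uu u0] := nU _ (@compact0 X).
by rewrite (_ : 0 = u)//; apply: val_inj; exact: etrans val0 (esym u0).
Qed.

Let B_T : B setT.
Proof.
split=> [|K cK]; first by apply/convexE.
apply: (@filterE _ (nbhs (0 : L1))) => f Kf.
have fc : f \in L1c_pred by apply/asboolP; exists K.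
by exists (MkL1c fc).
Qed.

Let B_I U V : B U -> B V -> B (U `&` V).
Proof.
move=> [cU nU] [cV nV]; split=> [|K cK].
  move/convexE in cU; move/convexE in cV.
  by apply/convexE => x y t t0 t1 [? ?] [? ?]; split; [exact: cU|exact: cV].
apply: (@filterS2 _ (nbhs (0 : L1)) _ _ _ _ _ (nU K cK) (nV K cK)).
move=> f Uf Vf Kf.
have [u Uu uf] := Uf Kf; have [v Vv vf] := Vf Kf.
exists u => //; split=> //; rewrite (_ : u = v)//.
by apply: val_inj => /=; rewrite uf.
Qed.

Let B_Z U a : a != 0 -> B U -> B [set u | U (a *: u)].
Proof.
move=> a0 [/convexE cU nU]; split=> [|K cK].
  apply/convexE => x y t t0 t1 /= Ux Uy.
  by rewrite scalerDr !scalerA !(mulrC a) -!scalerA; exact: cU.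
have := @scaler_continuous R L1 a 0; rewrite /continuous_at/= scaler0.
move=> /(_ _ (nU K cK)); apply: (@filterS _ (nbhs (0 : L1))) => f /= Uaf Kf.
have [u Uu uf] := Uaf (L1KZ a Kf).
exists (a^-1 *: u); first by rewrite /= scalerA mulfV// scale1r.
by rewrite valZ uf scalerA mulVf// scale1r.
Qed.

Let B_half U u v : B U -> U (2 *: u) -> U (2 *: v) -> U (u + v).
Proof.
move=> [/convexE cU _] Uu Uv.
have := cU _ _ 2^-1 _ _ Uu Uv.
rewrite !scalerA (_ : 1 - 2^-1 = 2^-1); last by lra.
by rewrite mulVf// !scale1r; apply; lra.
Qed.

Let B_absorb U (x : L1c) : B U -> \forall t \near (0 : R), U (t *: x).
Proof.
move=> [_ nU]; have /asboolP[K cK Kx] := L1c_valP x.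
have := @scalel_continuous R L1 (L1c_val x) 0; rewrite /continuous_at/= scale0r.
move=> /(_ _ (nU K cK)).
apply: (@filterS _ (nbhs (0 : R))) => t /= /(_ (L1KZ t Kx))[u Uu utx].
rewrite (_ : t *: x = u)//; apply: val_inj.
exact: etrans (valZ _ _) (esym utx).
Qed.

Let lc_filter (x : L1c) : ProperFilter (nbhs x).
Proof.
apply: Build_ProperFilter_ex.
  by move=> A [U BU UA]; exists (x + 0); apply: UA; exact: B_0.
split; first by exists setT.
  move=> P Q [U BU UP] [V BV VQ]; exists (U `&` V); first exact: B_I.
  by move=> u [Uu Vu]; split; [exact: UP|exact: VQ].
by move=> P Q PQ [U BU UP]; exists U => // u /UP/PQ.
Qed.

Let lc_singleton (x : L1c) (A : set L1c) : nbhs x A -> A x.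
Proof. by move=> [U BU /(_ 0 (B_0 BU))]; rewrite addr0. Qed.

Let lc_nbhs (x : L1c) (A : set L1c) : nbhs x A -> nbhs x (nbhs^~ A).
Proof.
move=> [U BU UA]; exists [set u | U (2 *: u)]; first exact: B_Z.
move=> u Uu; exists [set u | U (2 *: u)]; first exact: B_Z.
by move=> v Uv; rewrite -addrA; apply: UA; exact: B_half.
Qed.

HB.instance Definition _ :=
  Nbhs_isNbhsTopological.Build L1c lc_filter lc_singleton lc_nbhs.

Let lc_add : continuous (fun p : L1c * L1c => p.1 + p.2).
Proof.
move=> [x y] A [U BU UA].
pose V := [set u | U (2 *: u)]; have BV : B V by exact: B_Z.
exists ([set z | V (z - x)], [set z | V (z - y)]).
  by split; exists V => //= u Vu; rewrite addrC addKr.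
move=> [x' y'] /= [Vx Vy].
rewrite (_ : x' + y' = x + y + ((x' - x) + (y' - y))).
  by apply: UA; exact: B_half.
by rewrite addrACA ![_ + (_ - _)]addrC !subrK.
Qed.

Let lc_scale : continuous (fun z : R^o * L1c => z.1 *: z.2).
Proof.
move=> [a x] A [U BU UA].
pose V := [set u | U (2 *: u)]; have BV : B V by exact: B_Z.
pose M := `|a| + 1; have M0 : 0 < M by rewrite ltr_wpDl.
pose W := [set v | V (M *: v)] `&` [set v | V (- M *: v)].
have BW : B W by apply: B_I; apply: B_Z => //; rewrite ?oppr_eq0 gt_eqF.
exists ([set b : R^o | V ((b - a) *: x) /\ `|b| <= M], [set z | W (z - x)]).
  split; last by exists W => //= u Wu; rewrite addrC addKr.
  apply: filterI.
    have : (fun b : R^o => b - a) @ nbhs a --> (0 : R).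
      rewrite -[X in _ --> X](subrr a).
      by apply: cvgB; [exact: cvg_id|exact: cvg_cst].
    by move=> /(_ _ (B_absorb x BV)).
  have : Num.norm @ nbhs (a : R^o) --> `|a| by apply: cvg_norm; exact: cvg_id.
  move=> /cvgr_le; apply; by rewrite /M ltrDl.
move=> [b z] /= [[Vb bM] [W1 W2]].
rewrite (_ : b *: z = a *: x + ((b - a) *: x + b *: (z - x))); last first.
  by rewrite scalerBl scalerBr addrA [a *: x + _]addrC subrK addrC subrK.
apply: UA; apply: B_half => //.
have [/convexE cV _] := BV.
pose t := (1 + b / M) / 2.
have -> : b *: (z - x) = t *: (M *: (z - x)) + (1 - t) *: (- M *: (z - x)).
  rewrite !scalerA -scalerDl; congr (_ *: _).
  by rewrite /t; field; rewrite gt_eqF.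
apply: cV W1 W2; rewrite /t.
- move: bM; rewrite ler_norml => /andP[Mb _].
  by rewrite divr_ge0// -lerBlDl sub0r ler_pdivlMr// mulN1r.
- move: bM; rewrite ler_norml => /andP[_ bM].
  rewrite ler_pdivrMr// mul1r -lerBrDl ler_pdivrMr//.
  by rewrite (_ : 2 - 1 = 1) ?mul1r//; lra.
Qed.

Let lc_convex : exists2 C : set_system L1c,
  (forall V, V \in C -> convex_set V) & basis C.
Proof.
exists [set A | open A /\ convex_set A] => [A|]; first by rewrite inE => -[].
split=> [A []//|x A [U BU UA]].
pose C := [set z | U (z - x)].
have cC y z t : 0 <= t -> t <= 1 -> C y -> C z -> C (t *: y + (1 - t) *: z).
  move=> t0 t1 Cy Cz; rewrite /C/=.
  rewrite (_ : _ - x = t *: (y - x) + (1 - t) *: (z - x)).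
    by have [/convexE cU _] := BU; exact: cU.
  by rewrite !scalerBr addrACA -opprD -scalerDl addrCA subrr addr0 scale1r.
exists C°; last first.
  move=> y /interior_subset Cy; rewrite -(subrK x y) addrC.
  exact: UA.
split; last by exists U => //= u Uu; rewrite /C/= addrC addKr.
split; first exact: open_interior.
apply/convexE => y z t t0 t1 [V BV VC] [W BW WC].
exists (V `&` W); first exact: B_I.
move=> u [Vu Wu]; rewrite (_ : _ + u = t *: (y + u) + (1 - t) *: (z + u)).
  by apply: cC => //; [exact: VC|exact: WC].
by rewrite !scalerDr addrACA -scalerDl addrCA subrr addr0 scale1r.
Qed.

HB.instance Definition _ :=
  PreTopologicalLmod_isTvs.Build R L1c lc_add lc_scale lc_convex.

(* On each [L1K K] with K compact, this is the inclusion map. *)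
Definition toL1c : L1 -> L1c := insubd 0.

Lemma toL1cK K f : compact K -> L1K K f -> L1c_val (toL1c f) = f.
Proof. by move=> cK Kf; apply: insubdK; apply/asboolP; exists K. Qed.

Lemma lcdlimP (F : tvsType R) (phi : {linear L1c -> F}) :
  continuous phi <->
  forall K, compact K -> {within L1K K, continuous (phi \o toL1c)}.
Proof.
split=> [cphi K cK|cphi x A].
  apply/subspace_continuousP => f Kf.
  apply: (@cvg_comp _ _ _ toL1c phi _ (nbhs (toL1c f))); last exact: cphi.
  move=> A [U [_ nU] UA].
  have : (fun g : L1 => g - f) @ nbhs (f : L1) --> (f - f : L1).
    by apply: cvgB; [exact: cvg_id|exact: cvg_cst].
  rewrite subrr => /(_ _ (nU K cK)).
  apply: (@filterS _ (nbhs (f : L1))) => g /= Ug Kg.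
  have [u Uu ugf] := Ug (L1KB Kg Kf).
  rewrite /= (_ : toL1c g = toL1c f + u); first exact: UA.
  apply: val_inj; apply: (etrans _ (esym (valD _ _))).
  by rewrite ugf (toL1cK cK Kf) addrC subrK; exact: toL1cK cK Kg.
move=> /= nA.
have nA0 : nbhs (0 : F) [set y | A (phi x + y)].
  have := @add_continuous F (phi x, 0) A; rewrite /= addr0 => /(_ nA).
  move=> [[P Q] /= [/nbhs_singleton Px Q0] PQA].
  by apply: filterS Q0 => y Qy; apply: (PQA (phi x, y)).
have [C cC [oC bC]] := @locally_convex R F.
have [b [Cb b0] bA] := bC _ _ nA0.
have cb : convex_set b by apply: cC; rewrite inE.
exists (phi @^-1` b); last by move=> u /bA; rewrite /= linearD.
split.
  apply/convexE => y z t t0 t1 /= By Bz; rewrite linearD !linearZ/=.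
  by apply/set_mem; apply: (cb _ _ (Itv01 t0 t1)); rewrite inE.
move=> K cK; have /subspace_continuousP/(_ 0 (L1K0 K)) := cphi K cK.
have t0 : phi (toL1c 0) = 0.
  rewrite (_ : toL1c 0 = 0) ?linear0//; apply: val_inj.
  by apply: (etrans _ (esym val0)); apply: toL1cK cK _; exact: L1K0.
have nb : nbhs (phi (toL1c 0)) b.
  by rewrite t0; apply: open_nbhs_nbhs; split=> //; exact: oC.
move=> /(_ b nb); apply: (@filterS _ (nbhs (0 : L1))) => f /= bf Kf.
by exists (toL1c f); [exact: bf|rewrite (toL1cK cK)].
Qed.

End L1c.

Definition sigma_compact (X : topologicalType) :=
  exists K : (set X)^nat,
    (forall n, compact (K n)) /\ \bigcup_n K n = [set: X].

Record radon_measure (R : realType) (X : ptopologicalType)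
    (mu : {measure set (borel X) -> \bar R}) : Prop := {
  radon_compact_fin : forall K : set X, compact K -> (mu K < +oo)%E;
  radon_inner_regular : forall A : set (borel X), measurable A ->
    mu A = ereal_sup [set mu K | K in [set K : set X | compact K /\ K `<=` A]]
}.

Record left_haar_measure (R : realType) (G : topologicalGroupType)
    (mu : {measure set (borel G) -> \bar R}) : Prop := {
  haar_radon : radon_measure mu;
  haar_neq0 : exists2 A : set (borel G), measurable A & mu A != 0%E;
  haar_left_invariant : forall (x : G) (A : set (borel G)), measurable A ->
    mu [set (x * y)%g | y in (A : set G)] = mu A
}.

Section convolution.
Context (R : realType) (G : topologicalGroupType).
Variable mu : {measure set (borel G) -> \bar R}.
Implicit Types f g h : L1c mu.

Definition is_convolution f g h :=
  {ae mu, forall x : borel G,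
    mu.-integrable setT
      (fun y : borel G => (f y * g ((y : G)^-1 * x)%g)%:E) /\
    h x = \int[mu]_y (f y * g ((y : G)^-1 * x)%g)}.

Lemma is_convolution_unique f g h h' :
  is_convolution f g h -> is_convolution f g h' -> h = h'.
Proof.
move=> fgh fgh'; do 2!apply: val_inj; apply: ae_inj.
by apply: filterS2 fgh fgh' => x [_ hx] [_ h'x]; rewrite [LHS]hx [RHS]h'x.
Qed.

(* The class f * g. For a left Haar measure on a locally compact group it
   exists by Fubini's theorem, so that the default value is never used. *)
Definition convolution f g : L1c mu := xget 0 (is_convolution f g).

End convolution.

(* Main.v *)
Require Import Defs.
From HB Require Import structures.
From mathcomp Require Import all_boot all_order all_algebra.
From mathcomp Require Import finmap.
From mathcomp Require Import all_classical all_reals all_analysis.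
From mathcomp Require Import measurable_realfun ring lra.

Set Implicit Arguments.
Unset Strict Implicit.
Unset Printing Implicit Defensive.

Import Order.TTheory GRing.Theory Num.Theory.
Import numFieldNormedType.Exports.

Local Open Scope classical_set_scope.
Local Open Scope ring_scope.

(** Write |f| for the L^1-norm of f and 1_A for the indicator function of A.
    Both implications reduce to a question about arrays of positive numbers
    w(i, j): is there a product majorant, i.e. are there positive a_i and b_j
    such that w(i, j) <= a_i b_j for all i and j?  Over a countable index set
    the answer is always yes; over an uncountable one it may be no.

    Sufficiency.  A sigma-compact G is exhausted by compact sets L_0, L_1, ...
    such that every compact set lies in some L_n.  Cut functions along the
    layers A_n = L_n \ L_(n-1).  A convex neighbourhood U of 0 contains the
    ball of some radius eps_k in the space of functions supported by L_k.  If
    sum_n v_n |f 1_(A_n)| <= 1 and likewise for g, bilinearity expands f * g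
    into products of layers f_i * g_j, and this expansion is a sub-convex
    combination with coefficients v_i |f_i| v_j |g_j| of functions of norm at
    most 1 / (v_i v_j), each supported by the L_k that contains L_i L_j.  So
    f * g lies in U as soon as 2 / eps_k(i, j) <= v_i v_j, and
    [product_majorant] provides such weights v.

    Necessity.  Let G be not sigma-compact.  Well-order G, fix a compact
    neighbourhood V_0 of 1, put V = V_0 V_0, and keep the elements i that do not
    belong to the subgroup generated by V and the elements before i.  Since
    these elements generate G together with V, there are uncountably many of
    them; discarding some, each of them has only countably many predecessors,
    which an injection e_i numbers.  The blocks i V j, for j before i, form a
    locally finite family ([block_unique], [blocks_locally_finite]), so that the
    conditions (e_i(j) + 1) |h 1_(i V j)| <= 1 define a neighbourhood U of 0.
    Were convolution continuous at 0, there would be nonzero nonnegative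
    functions f_i supported by i V_0 and g_j supported by V_0 j such that
    f_i * g_j satisfies the condition of U on the block i V j, which supports
    it.  As |f_i * g_j| = |f_i| |g_j|, this bounds e_i(j) + 1 by the product of
    1 / |f_i| and 1 / |g_j|, which is impossible over an uncountable index set
    ([no_product_majorant]).

    Both directions use that the convolution of two classes exists, with
    |f * g| <= |f| |g| and equality for nonnegative f and g.  This is Tonelli's
    theorem for (y, x) |-> f(y) g(y^-1 x), a function that is Borel on G x G but
    may fail to be measurable for the product sigma-algebra when G is not
    second countable.  [borel_tonelli] therefore treats Borel functions on a
    product of topological spaces: for an open set the inner regularity of the
    measures reduces the claim to finite unions of rectangles, and a pi-lambda
    argument passes to all Borel sets. *)

(** * Tonelli's theorem from a generating pi-system *)

Section tonelli_kernel.
Local Open Scope ereal_scope.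
Context d1 d2 d3 (X : measurableType d1) (Y : measurableType d2)
  (Z : measurableType d3) (R : realType) (p : X -> Y -> Z).
Variable n : {finite_measure set Y -> \bar R}.
Hypothesis mp : forall x, measurable_fun setT (p x).
Hypothesis mn : forall E, measurable E ->
  measurable_fun setT (fun x => n (p x @^-1` E)).

(** The measure E |-> n(E_x), where E_x is the section of E at x. Through [p],
    the set Z stands for X * Y with a sigma-algebra that may be larger than the
    product one. *)
Definition section_measure x : {measure set Z -> \bar R} :=
  measure_function_pushforward__canonical__measure_function_Measure n (mp x).

(** Composing kernels turns iterated integrals into integrals against one
    measure on Z; the parameter space [unit] makes the outer measure a kernel. *)
Definition section_kernel (u : unit * X) : {measure set Z -> \bar R} :=
  section_measure u.2.

Let section_kernel_meas U : measurable U ->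
  measurable_fun setT (section_kernel^~ U).
Proof.
by move=> mU; exact: measurableT_comp (mn mU) measurable_snd.
Qed.

HB.instance Definition _ :=
  @isKernel.Build _ _ (unit * X)%type Z R section_kernel section_kernel_meas.

Let section_kernel_uub : measure_fam_uub section_kernel.
Proof.
exists (fine (n setT) + 1)%R => u; rewrite /= /pushforward preimage_setT.
rewrite EFinD fineK ?fin_num_measure//.
by rewrite lteDl ?fin_num_measure ?lte01.
Qed.

HB.instance Definition _ :=
  @Kernel_isFinite.Build _ _ (unit * X)%type Z R section_kernel section_kernel_uub.

Variable m : {finite_measure set X -> \bar R}.

Definition cst_kernel (_ : unit) : {measure set X -> \bar R} := m.

Let cst_kernel_meas U : measurable U -> measurable_fun setT (cst_kernel^~ U).
Proof. by move=> mU; exact: measurable_cst. Qed.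

HB.instance Definition _ :=
  @isKernel.Build _ _ unit X R cst_kernel cst_kernel_meas.

Let cst_kernel_uub : measure_fam_uub cst_kernel.
Proof.
exists (fine (m setT) + 1)%R => u.
rewrite EFinD fineK ?fin_num_measure//.
by rewrite lteDl ?fin_num_measure ?lte01.
Qed.

HB.instance Definition _ :=
  @Kernel_isFinite.Build _ _ unit X R cst_kernel cst_kernel_uub.

Definition iterated_measure : {measure set Z -> \bar R} :=
  (cst_kernel \; section_kernel) tt.

Lemma iterated_measureE E : iterated_measure E = \int[m]_x n (p x @^-1` E).
Proof. by []. Qed.

Lemma measurable_fun_section_integral (F : Z -> \bar R) :
  (forall z, 0 <= F z) -> measurable_fun setT F ->
  measurable_fun setT (fun x => \int[n]_y F (p x y)).
Proof.
move=> F0 mF.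
rewrite [X in measurable_fun _ X](_ : _ = fun x => \int[section_measure x]_z F z).
  by apply: measurable_fun_integral_kernel => // U mU; exact: mn.
by apply/funext => x; rewrite (ge0_integral_pushforward (mp x)).
Qed.

Lemma integral_iterated_measure (F : Z -> \bar R) :
  (forall z, 0 <= F z) -> measurable_fun setT F ->
  \int[iterated_measure]_z F z = \int[m]_x \int[n]_y F (p x y).
Proof.
move=> F0 mF; rewrite (@integral_kcomp _ _ _ _ _ _ R cst_kernel section_kernel)//.
by apply: eq_integral => x _; rewrite (ge0_integral_pushforward (mp x)).
Qed.

End tonelli_kernel.

(** As n is finite, the sets E for which n(E_x) depends measurably on x are
    closed under complements and countable disjoint unions. *)
Lemma measurable_fun_section_dynkin d1 d2 d3 (X : measurableType d1)
    (Y : measurableType d2) (Z : measurableType d3) (R : realType)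
    (p : X -> Y -> Z) (n : {finite_measure set Y -> \bar R})
    (O : set (set Z)) :
  (forall x, measurable_fun setT (p x)) ->
  @measurable _ Z = <<s O >> -> setI_closed O ->
  (forall E, O E -> measurable_fun setT (fun x => n (p x @^-1` E))) ->
  forall E, measurable E -> measurable_fun setT (fun x => n (p x @^-1` E)).
Proof.
move=> mp ZO OI mO E; rewrite ZO.
have mpE x A : measurable A -> measurable (p x @^-1` A).
  by move=> mA; rewrite -[X in measurable X]setTI; exact: mp.
move: E; apply: (dynkin_induction ZO OI) => //.
- rewrite [X in measurable_fun _ X](_ : _ = cst (n setT)); first exact: measurable_cst.
  by apply/funext => x; rewrite preimage_setT.
- move=> S mS mnS.
  rewrite [X in measurable_fun _ X](_ : _ = (fun x => n setT - n (p x @^-1` S))%E).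
    by apply: emeasurable_funB => //; exact: measurable_cst.
  apply/funext => x; have mx := mpE x _ mS.
  rewrite [in LHS](_ : p x @^-1` _ = setT `\` (p x @^-1` S)); last by rewrite setTD.
  by rewrite measureD// ?setTI//; exact: fin_num_fun_lty.
- move=> F mF tF mnF.
  rewrite [X in measurable_fun _ X](_ : _ =
      (fun x => \sum_(k <oo) n (p x @^-1` F k))%E).
    by apply: ge0_emeasurable_sum => // k x _ _; apply: measure_ge0; exact: mpE.
  apply/funext => x; rewrite preimage_bigcup measure_bigcup//=.
  - by apply: eq_eseriesl => k; rewrite in_setT.
  - by move=> k _; exact: mpE.
  - apply/trivIsetP => i j _ _ ij; rewrite -preimage_setI.
    by move/trivIsetP : tF => ->//; rewrite preimage_set0.
Qed.

(** The two iterated integrals are integrals against two finite measures on Z;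
    these are equal because they agree on a generating pi-system. *)
Lemma tonelli_pi_system d1 d2 d3 (X : measurableType d1)
    (Y : measurableType d2) (Z : measurableType d3) (R : realType)
    (p : X -> Y -> Z) (m : {finite_measure set X -> \bar R})
    (n : {finite_measure set Y -> \bar R}) (O : set (set Z)) :
  (forall x, measurable_fun setT (p x)) ->
  (forall y, measurable_fun setT (p^~ y)) ->
  @measurable _ Z = <<s O >> -> setI_closed O -> O setT ->
  (forall E, O E -> measurable_fun setT (fun x => n (p x @^-1` E))) ->
  (forall E, O E -> measurable_fun setT (fun y => m (p^~ y @^-1` E))) ->
  (forall E, O E ->
    \int[m]_x n (p x @^-1` E) = \int[n]_y m (p^~ y @^-1` E))%E ->
  forall F : Z -> \bar R, (forall z, 0 <= F z)%E -> measurable_fun setT F ->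
  [/\ measurable_fun setT (fun x => \int[n]_y F (p x y))%E,
      measurable_fun setT (fun y => \int[m]_x F (p x y))%E &
      (\int[m]_x \int[n]_y F (p x y) = \int[n]_y \int[m]_x F (p x y))%E].
Proof.
move=> mpX mpY ZO OI OT mnO mmO eqO F F0 mF.
have mn := measurable_fun_section_dynkin mpX ZO OI mnO.
have mm := @measurable_fun_section_dynkin _ _ _ Y X Z R
  (fun y x => p x y) m O mpY ZO OI mmO.
split.
- exact: measurable_fun_section_integral.
- exact: (@measurable_fun_section_integral _ _ _ Y X Z R (fun y x => p x y) m).
rewrite -(integral_iterated_measure mpX mn)//.
rewrite -(@integral_iterated_measure _ _ _ Y X Z R (fun y x => p x y) m mpY mm)//.
apply: eq_measure_integral => E mE _.
apply: (measure_unique O (fun=> setT)) => //.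
  by apply/seteqP; split => // z _; exists 0%N.
move=> _; rewrite iterated_measureE.
under eq_integral do rewrite preimage_setT.
rewrite integral_cst//.
rewrite -ge0_fin_numE ?mule_ge0//.
by rewrite fin_numM// fin_num_measure.
Qed.

(** * Borel sets and sections of open sets *)

Section borel.
Context (X : ptopologicalType).

Lemma borel_open (A : set X) : open A -> measurable (A : set (borel X)).
Proof. exact: sub_sigma_algebra. Qed.

Lemma borel_closed (A : set X) : closed A -> measurable (A : set (borel X)).
Proof.
move=> cA; rewrite -(setCK A); apply: measurableC.
by apply: borel_open; exact: closed_openC.
Qed.

Lemma borel_compact (A : set X) : hausdorff_space X -> compact A ->
  measurable (A : set (borel X)).
Proof. by move=> hX cA; apply: borel_closed; exact: compact_closed. Qed.

Lemma borel_continuous (Y : ptopologicalType) (f : X -> Y) : continuous f ->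
  measurable_fun setT (f : borel X -> borel Y).
Proof.
move=> cf; apply: (@measurability _ _ (borel X) (borel Y) _ _ (@open Y)) => //.
move=> _ [U oU <-]; rewrite setTI; apply: borel_open.
by move/continuousP : cf; exact.
Qed.

(** The sets where a lower semicontinuous function exceeds a are open. *)
Lemma borel_lower_semicontinuous (R : realType) (f : X -> \bar R) :
  (forall x a, (a%:E < f x)%E -> \forall y \near x, (a%:E < f y)%E) ->
  measurable_fun setT (f : borel X -> \bar R).
Proof.
move=> lsc; apply: (measurability _ (ErealGenOInfty.measurableE R)).
move=> /= _ [_ [a ->]] <-; apply: measurableI => //; apply: borel_open.
rewrite preimage_itvoy openE => x /= ax; exact: lsc.
Qed.

End borel.

Definition inner_regular (R : realType) (X : ptopologicalType)
    (m : set (borel X) -> \bar R) :=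
  forall (A : set (borel X)) (e : R), measurable A -> 0 < e ->
    exists K : set X, [/\ compact K, K `<=` A & (m A <= m K + e%:E)%E].

Section open_sections.
Local Open Scope ereal_scope.
Context (R : realType) (X Y : ptopologicalType).
Hypothesis hY : hausdorff_space Y.
Variable n : {finite_measure set (borel Y) -> \bar R}.
Hypothesis rn : inner_regular n.
Variables (E : set (X * Y)) (oE : open E).

Lemma measurable_open_section x : measurable (pair x @^-1` E : set (borel Y)).
Proof.
apply: borel_open; rewrite openE => y Exy.
by move: oE; rewrite openE => /(_ _ Exy) [[P Q] /= [/nbhs_singleton Px Qy] PQ];
  apply: filterS Qy => z Qz; exact: (PQ (x, z)).
Qed.

(** Tube lemma: by compactness, finitely many rectangles inside E cover the
    slice over x. *)
Lemma tube (C : set Y) x : compact C -> C `<=` pair x @^-1` E ->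
  \forall z \near x, C `<=` pair z @^-1` E.
Proof.
move=> /compact_near_coveringP cC CE; apply: cC => y Cy.
move: oE; rewrite openE => /(_ _ (CE _ Cy)) [[P Q] /= [Px Qy] PQ].
by exists (Q, P) => // -[y' x'] /= [Qy' Px']; exact: (PQ (x', y')).
Qed.

Lemma inner_section x a : a%:E < n (pair x @^-1` E) ->
  exists2 C : set Y, compact C /\ C `<=` pair x @^-1` E & a%:E < n C.
Proof.
move=> an; have mx := measurable_open_section x.
have nfin : n (pair x @^-1` E) \is a fin_num by exact: fin_num_measure.
pose e := (fine (n (pair x @^-1` E)) - a)%R.
have e0 : (0 < e)%R by rewrite subr_gt0 -lte_fin fineK.
have [C [cC CE nC]] : exists K : set Y, [/\ compact K, K `<=` pair x @^-1` E &
    n (pair x @^-1` E) <= n K + (e / 2)%:E].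
  by apply: rn => //; rewrite divr_gt0.
exists C => //; move: nC; rewrite -(fineK nfin).
have Cfin : n C \is a fin_num by apply: fin_num_measure; exact: borel_compact.
by rewrite -(fineK Cfin) -EFinD lee_fin lte_fin; move: e0; rewrite /e; lra.
Qed.

(** If n(E_x) > a then E_x contains a compact set of measure > a, which by the
    tube lemma stays inside the sections at nearby points: the measure of the
    section is lower semicontinuous in x. *)
Lemma measurable_fun_open_section :
  measurable_fun setT (fun x : borel X => n (pair x @^-1` E)).
Proof.
apply: borel_lower_semicontinuous => x a /inner_section[C [cC CE] aC].
have := tube cC CE; apply: filterS => z Cz; apply: (lt_le_trans aC).
by apply: le_measure; rewrite ?inE//; [exact: borel_compact|
  exact: measurable_open_section].
Qed.

(** Approximation from within, by finitely many rectangles (open set) x (compact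
    set), of the part of E over K. Rectangles matter because for them the two
    iterated integrals are known to agree. *)
Lemma rectangles_cover (K : set X) a : compact K ->
  (forall x, K x -> a%:E < n (pair x @^-1` E)) ->
  exists S : set (borel X * borel Y), [/\ measurable S, S `<=` E &
    forall x, K x -> a%:E < n (xsection S x)].
Proof.
rewrite compact_cover => cK Ka.
have /choice[C PC] x : exists C : set Y, K x -> [/\ compact C,
    C `<=` pair x @^-1` E & a%:E < n C].
  have [Kx|nKx] := pselect (K x); last by exists set0.
  by have [C [? ?] ?] := inner_section (Ka x Kx); exists C.
pose W x := [set z | C x `<=` pair z @^-1` E]°.
have [D DK KD] : finite_subset_cover K W K.
  apply: cK => [x _|x Kx]; first exact: open_interior.
  by have [cC CE _] := PC x Kx; exists x => //; exact: tube cC CE.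
exists (\bigcup_(x in [set` D]) (W x `*` C x)); split.
- apply: fin_bigcup_measurable => // x Dx.
  have [cC _ _] := PC x (set_mem (DK _ Dx)).
  apply: measurableX; last exact: borel_compact.
  by apply: borel_open; exact: open_interior.
- by move=> [x y] [z _ [/= /interior_subset Wx Cy]]; exact: Wx.
- move=> x /KD[z Dz Wzx].
  have [cC _ aC] := PC z (set_mem (DK _ Dz)).
  apply: (lt_le_trans aC); apply: le_measure; rewrite ?inE//.
  + exact: borel_compact.
  + apply: measurable_xsection; apply: fin_bigcup_measurable => // x' Dx.
    have [cC' _ _] := PC x' (set_mem (DK _ Dx)).
    apply: measurableX; last exact: borel_compact.
  by apply: borel_open; exact: open_interior.
  + by move=> y Cy; rewrite /xsection/= inE; exists z.
Qed.

End open_sections.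

(** This lemma and the next one are the two halves of the layer cake formula with
    steps of height d: a bounded number is at most d plus the total height of
    the levels below it, and a number that lies above the selected levels
    dominates their total height. *)
Lemma le_layers (R : realDomainType) (f d : R) (J : nat) : 0 <= d ->
  f <= J.+1%:R * d -> f <= d + \sum_(j < J) d * (j.+1%:R * d < f)%R%:R.
Proof.
move=> d0; elim: J => [|J IH] fJ.
  by rewrite big_ord0 addr0 (le_trans fJ)// mul1r.
have [{}/IH IH|Jf] := leP f (J.+1%:R * d).
  by rewrite big_ord_recr/= addrA (le_trans IH)// lerDl mulr_ge0.
rewrite (eq_bigr (fun=> d)) => [|j _].
  by rewrite sumr_const card_ord -mulr_natl (le_trans fJ)//
    -[in leRHS](mul1r d) mulrA mulr1 -mulrDl nat1r.
by rewrite (le_lt_trans _ Jf) ?mulr1// ler_wpM2r// ler_nat.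
Qed.

Lemma layers_le (R : realDomainType) (g d : R) (J : nat) (b : nat -> bool) :
  0 <= d -> 0 <= g -> (forall j, (j < J)%N -> b j -> j.+1%:R * d <= g) ->
  \sum_(j < J) d * (b j)%:R <= g.
Proof.
move=> d0 g0; elim: J => [|J IH] bg; first by rewrite big_ord0.
have [bJ|nbJ] := boolP (b J); last first.
  rewrite big_ord_recr/= (negbTE nbJ) mulr0 addr0; apply: IH => j jJ.
  by apply: bg; rewrite ltnS ltnW.
apply: (le_trans _ (bg J (ltnSn _) bJ)).
have -> : J.+1%:R * d = \sum_(j < J.+1) d.
  by rewrite sumr_const card_ord mulr_natl.
by apply: ler_sum => j _; rewrite -[leRHS]mulr1 ler_wpM2l// lern1; case: (b j).
Qed.

Lemma integral_layers d (T : measurableType d) (R : realType)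
    (m : {measure set T -> \bar R}) (A : nat -> set T) (c : R) (J : nat) :
  0 <= c -> (forall j, measurable (A j)) ->
  (\int[m]_x (\sum_(j < J) c * \1_(A j) x)%:E = \sum_(j < J) c%:E * m (A j))%E.
Proof.
move=> c0 mA; under eq_integral do rewrite -sumEFin.
rewrite ge0_integral_sum//.
- apply: eq_bigr => j _; under eq_integral do rewrite EFinM.
  by rewrite ge0_integralZl_EFin// ?integral_indic// ?setIT//;
    apply/measurable_EFinP; exact: measurable_indic.
- by move=> j; apply/measurable_EFinP/measurable_funM => //; exact: measurable_indic.
- by move=> j x _; rewrite lee_fin mulr_ge0.
Qed.

Section open_iterated.
Local Open Scope ereal_scope.
Context (R : realType) (X Y : ptopologicalType).
Hypothesis (hX : hausdorff_space X) (hY : hausdorff_space Y).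
Variables (m : {finite_measure set (borel X) -> \bar R})
  (n : {finite_measure set (borel Y) -> \bar R}).
Hypothesis (rm : inner_regular m) (rn : inner_regular n).

(** The idea: approximate x |-> n(E_x) by a step function with levels c, 2c, ...,
    replace each superlevel set by a compact subset, and put finitely many
    rectangles in E over each of these compact sets. The union T of the
    rectangles satisfies the inequality by the classical Tonelli theorem, and it
    misses at most e of the left-hand side. *)
Lemma open_iterated_le (E : set (X * Y)) : open E ->
  measurable_fun setT (fun y : borel Y => m (pair^~ y @^-1` E)) ->
  (forall y, measurable (pair^~ y @^-1` E : set (borel X))) ->
  \int[m]_x n (pair x @^-1` E) <= \int[n]_y m (pair^~ y @^-1` E).
Proof.
move=> oE mmE mE; have mnE := measurable_fun_open_section hY rn oE.
pose f x := fine (n (pair x @^-1` E)).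
have fE x : n (pair x @^-1` E) = (f x)%:E.
  by rewrite fineK// fin_num_measure//; exact: measurable_open_section.
have f0 x : (0 <= f x)%R by apply: fine_ge0.
(* J is such that (J + 1) c bounds n(Y). The step c costs c m(X) <= e / 2, and
   losing measure eta on each of J levels costs J c eta <= e / 2. *)
apply/lee_addgt0Pr => e e0.
pose mX := fine (m setT); have mX0 : (0 <= mX)%R by exact: fine_ge0.
have mXE : m setT = mX%:E by rewrite fineK ?fin_num_measure.
pose M := fine (n setT).
have fM x : (f x <= M)%R.
  rewrite -lee_fin -fE fineK ?fin_num_measure//.
  by apply: le_measure; rewrite ?inE//; exact: measurable_open_section.
pose c := (e / 2 / (mX + 1))%R.
have c0 : (0 < c)%R by rewrite !divr_gt0// ltr_wpDl.
pose J := Num.truncn (M / c).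
have MJ : (M <= J.+1%:R * c)%R by rewrite -ler_pdivrMr// ltW// truncnS_gt.
pose eta := (e / 2 / (J.+1%:R * c))%R.
have eta0 : (0 < eta)%R by rewrite !divr_gt0// mulr_gt0.
pose U j := [set x | (j.+1%:R * c)%:E < n (pair x @^-1` E)].
have mU j : measurable (U j : set (borel X)).
  have := mnE measurableT `](j.+1%:R * c)%:E, +oo[%classic (emeasurable_itv _).
  by rewrite setTI preimage_itvoy.
have /choice[K PK] j : exists K : set X,
    [/\ compact K, K `<=` U j & m (U j) <= m K + eta%:E].
  exact: rm.
have mK j : measurable (K j : set (borel X)).
  by have [cK _ _] := PK j; exact: borel_compact.
have /choice[S PS] j : exists S : set (borel X * borel Y),
    [/\ measurable S, S `<=` E &
      forall x, K j x -> (j.+1%:R * c)%:E < n (xsection S x)].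
  have [cK KU _] := PK j; exact: (rectangles_cover hY rn oE cK).
pose T := \bigcup_(j in `I_J) S j.
have mT : measurable T.
  by apply: fin_bigcup_measurable => // j _; have [] := PS j.
have TE : T `<=` E by move=> z [j _]; have [_ SE _] := PS j; exact: SE.
have step1 : \int[m]_x n (pair x @^-1` E) <=
    \int[m]_x (c%:E + (\sum_(j < J) c * \1_(U j) x)%:E).
  apply: ge0_le_integral => //.
  - apply: emeasurable_funD; first exact: measurable_cst.
    apply/measurable_EFinP/measurable_sum => j.
    by apply: measurable_funM => //; exact: measurable_indic.
  - move=> x _; rewrite fE -EFinD lee_fin.
    have := le_layers (ltW c0) (le_trans (fM x) MJ).
    congr (_ <= _ + _)%R; apply: eq_bigr => j _.
    rewrite indicE; congr (_ * (_ : bool)%:R)%R.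
    by apply/idP/idP; rewrite inE /U/= fE lte_fin.
have step2 : \int[m]_x (c%:E + (\sum_(j < J) c * \1_(U j) x)%:E) =
    (c * mX)%:E + \sum_(j < J) c%:E * m (U j).
  rewrite ge0_integralD//.
  - rewrite integral_cst// integral_layers ?ltW//. by rewrite (EFinM c mX) -mXE.
  - by move=> x _; rewrite lee_fin ltW.
  - by move=> x _; rewrite lee_fin sumr_ge0// => j _; rewrite mulr_ge0// ltW.
  - apply/measurable_EFinP/measurable_sum => j.
    by apply: measurable_funM => //; exact: measurable_indic.
have step3 : \sum_(j < J) c%:E * m (U j) <=
    \sum_(j < J) c%:E * m (K j) + (e / 2)%:E.
  apply: (@le_trans _ _ (\sum_(j < J) (c%:E * m (K j) + (c * eta)%:E))).
    apply: lee_sum => j _; rewrite (EFinM c eta) -ge0_muleDr//;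
      last by rewrite lee_fin ltW.
    by rewrite lee_pmul2l//; have [] := PK j.
  rewrite big_split/= leeD2l// sumEFin lee_fin sumr_const card_ord -(mulr_natl _ J).
  have -> : (J%:R * (c * eta) = e / 2 * (J%:R / J.+1%:R))%R.
    by rewrite /eta invfM; field; rewrite ?(gt_eqF c0) ?nat1r ?pnatr_eq0 ?gt_eqF.
  by rewrite ler_piMr ?divr_ge0 ?ltW// ltr_pdivrMr// mul1r ltr_nat.
have step4 : \sum_(j < J) c%:E * m (K j) <= \int[m]_x n (xsection T x).
  rewrite -(integral_layers _ _ (ltW c0) mK); apply: ge0_le_integral => //.
  - move=> x _; rewrite lee_fin sumr_ge0// => j _; rewrite mulr_ge0// ltW//.
  - apply/measurable_EFinP/measurable_sum => j.
    by apply: measurable_funM => //; exact: measurable_indic.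
  - exact: measurable_fun_xsection.
  - move=> x _; have nT : n (xsection T x) = (fine (n (xsection T x)))%:E.
      by rewrite fineK// fin_num_measure//; exact: measurable_xsection.
    rewrite nT lee_fin.
    apply: (layers_le (b := fun j => x \in K j)); [exact: ltW|exact: fine_ge0|].
    move=> j jJ; rewrite inE => Kx; rewrite -lee_fin -nT.
    have [mS _ /(_ x Kx)/ltW Sx] := PS j; apply: (le_trans Sx).
    apply: le_measure; rewrite ?inE; [exact: measurable_xsection..|].
    by move=> y; rewrite /xsection/= !inE => Sxy; exists j.
(* Tonelli's theorem for the product sigma-algebra applies to T. *)
have step5 : \int[m]_x n (xsection T x) <= \int[n]_y m (pair^~ y @^-1` E).
  have := @indic_fubini_tonelli _ _ _ _ _ m n T mT.
  rewrite indic_fubini_tonelli_FE// indic_fubini_tonelli_GE// => ->.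
  apply: ge0_le_integral => //.
    by apply: measurable_fun_ysection.
  move=> y _; apply: le_measure; rewrite ?inE//; first exact: measurable_ysection.
  by move=> x; rewrite /ysection/= inE; exact: TE.
apply: (le_trans step1); rewrite step2.
have cmX : (c * mX <= e / 2)%R.
  rewrite /c mulrAC -mulrA ler_piMr ?ltW ?divr_gt0//.
  by rewrite ltr_pdivrMr ?mul1r ?ltrDl// ltr_wpDl.
apply: (@le_trans _ _ ((e / 2)%:E + (\int[n]_y m (pair^~ y @^-1` E) + (e / 2)%:E))).
  rewrite leeD ?lee_fin// (le_trans step3)// leeD2r//.
  exact: le_trans step4 step5.
by rewrite addeCA -EFinD -splitr.
Qed.

End open_iterated.

(** * Tonelli's theorem for Borel functions on a product space *)

(** Joins the product topology with the pointed structure of pairs, as the Borel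
    sigma-algebra [borel (X * Y)] requires. *)
HB.instance Definition _ (X Y : ptopologicalType) := Topological.on (X * Y)%type.

Section borel_tonelli.
Local Open Scope ereal_scope.
Context (R : realType) (X Y : ptopologicalType).
Hypothesis (hX : hausdorff_space X) (hY : hausdorff_space Y).
Variables (m : {finite_measure set (borel X) -> \bar R})
  (n : {finite_measure set (borel Y) -> \bar R}).
Hypothesis (rm : inner_regular m) (rn : inner_regular n).

(** Open sets form a pi-system that generates the Borel sets of X * Y, and on
    them both inequalities hold by [open_iterated_le]. *)
Theorem borel_tonelli (F : borel (X * Y)%type -> \bar R) :
  (forall z, 0 <= F z) -> measurable_fun setT F ->
  [/\ measurable_fun setT (fun x : borel X => \int[n]_y F (x, y)),
      measurable_fun setT (fun y : borel Y => \int[m]_x F (x, y)) &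
      \int[m]_x \int[n]_y F (x, y) = \int[n]_y \int[m]_x F (x, y)].
Proof.
move=> F0 mF.
have cswap : continuous (fun z : Y * X => (z.2, z.1)).
  by move=> z; apply: cvg_pair; [exact: cvg_snd|exact: cvg_fst].
have oswap (E : set (X * Y)) : open E -> open [set z : Y * X | E (z.2, z.1)].
  by move=> oE; move/continuousP : cswap; exact.
have mx (E : set (X * Y)) : open E ->
    measurable_fun setT (fun x : borel X => n (pair x @^-1` E)).
  by move=> oE; exact: measurable_fun_open_section.
have my (E : set (X * Y)) : open E ->
    measurable_fun setT (fun y : borel Y => m (pair^~ y @^-1` E)).
  by move=> /oswap oE; exact: (measurable_fun_open_section hX rm oE).
apply: (@tonelli_pi_system _ _ _ (borel X) (borel Y) (borel (X * Y)%type) R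
  (fun x y => (x, y)) m n (@open (X * Y)%type)) => //.
- move=> x; apply: (@borel_continuous Y (X * Y)%type (fun y => (x, y))) => y.
  by apply: cvg_pair; [exact: cvg_cst|exact: cvg_id].
- move=> y; apply: (@borel_continuous X (X * Y)%type (fun x => (x, y))) => x.
  by apply: cvg_pair; [exact: cvg_id|exact: cvg_cst].
- by move=> A B; exact: openI.
- exact: openT.
- move=> E oE; apply/eqP; rewrite eq_le; apply/andP; split.
    apply: (open_iterated_le hX hY rm rn oE (my _ oE)) => y.
    exact: (measurable_open_section (oswap _ oE)).
  apply: (open_iterated_le hY hX rn rm (oswap _ oE) (mx _ oE)) => x.
  exact: (measurable_open_section oE).
Qed.

End borel_tonelli.

Section compact_restriction.
Local Open Scope ereal_scope.
Context (R : realType) (X : ptopologicalType) (hX : hausdorff_space X).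
Variable mu : {measure set (borel X) -> \bar R}.
Variables (K : set X) (cK : compact K).

Let mK : measurable (K : set (borel X)) := borel_compact hX cK.

(** The argument of type [radon_measure mu] is there so that the finiteness of
    the restricted measure can be inferred from the term. *)
Definition compact_restr (_ : radon_measure mu) : set (borel X) -> \bar R :=
  mrestr mu mK.

Variable rmu : radon_measure mu.
Local Notation restr := (compact_restr rmu).

HB.instance Definition _ := Measure.copy restr (mrestr mu mK).

Let compact_restr_fin : fin_num_fun restr.
Proof.
move=> A mA; rewrite ge0_fin_numE//.
apply: le_lt_trans (radon_compact_fin rmu cK).
by apply: le_measure; rewrite ?inE//; exact: measurableI.
Qed.

HB.instance Definition _ :=
  @Measure_isFinite.Build _ _ R restr compact_restr_fin.

Lemma compact_restr_inner_regular : inner_regular restr.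
Proof.
move=> A e mA e0; have mAK : measurable (A `&` K) by exact: measurableI.
have rAK := radon_inner_regular rmu mAK.
have finAK : ereal_sup [set mu K0 | K0 in
    [set K0 : set X | compact K0 /\ K0 `<=` A `&` K]] \is a fin_num.
  by rewrite -rAK; exact: compact_restr_fin.
have [_ [C [cC CAK] <-] muC] := ub_ereal_sup_adherent e0 finAK.
exists C; split=> //; first by move=> x /CAK[].
rewrite /compact_restr /mrestr rAK (_ : C `&` K = C); last first.
  by rewrite setIidl// => x /CAK[].
by rewrite -leeBlDr// ltW.
Qed.

Lemma integral_compact_restr (f : borel X -> \bar R) :
  (forall x, 0 <= f x) -> measurable_fun setT f ->
  \int[restr]_x f x = \int[mu]_(x in K) f x.
Proof.
move=> f0 mf; rewrite -(setvU K) ge0_integral_setU//.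
- rewrite null_set_integral ?add0e//.
  + apply: eq_measure_integral => A mA AK; exact: (congr1 mu (setIidl AK)).
  + exact: measurableC.
  + exact: measurable_funTS.
  + by apply: etrans (congr1 mu (setICl K)) _; exact: measure0.
- exact: measurableC.
- by rewrite setvU.
- by apply/disj_setPS => x [].
Qed.

End compact_restriction.

(** A Radon measure need not be sigma-finite, but its restrictions to compact
    sets are finite and inner regular. *)
Theorem radon_tonelli (R : realType) (X : ptopologicalType)
    (hX : hausdorff_space X) (mu : {measure set (borel X) -> \bar R})
    (A B : set X) (F : borel (X * X)%type -> \bar R) :
  radon_measure mu -> compact A -> compact B ->
  (forall z, 0 <= F z)%E -> measurable_fun setT F ->
  [/\ measurable_fun setT (fun x : borel X => \int[mu]_(y in B) F (x, y))%E,
      measurable_fun setT (fun y : borel X => \int[mu]_(x in A) F (x, y))%E &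
      (\int[mu]_(x in A) \int[mu]_(y in B) F (x, y) =
       \int[mu]_(y in B) \int[mu]_(x in A) F (x, y))%E].
Proof.
move=> rmu cA cB F0 mF.
have mFx x : measurable_fun setT (fun y : borel X => F (x, y)).
  apply: (measurableT_comp mF).
  apply: (@borel_continuous X (X * X)%type (fun y => (x, y))) => y.
  by apply: cvg_pair; [exact: cvg_cst|exact: cvg_id].
have mFy y : measurable_fun setT (fun x : borel X => F (x, y)).
  apply: (measurableT_comp mF).
  apply: (@borel_continuous X (X * X)%type (fun x => (x, y))) => x.
  by apply: cvg_pair; [exact: cvg_id|exact: cvg_cst].
have [mx my] := @borel_tonelli R X X hX hX
  (compact_restr hX cA rmu) (compact_restr hX cB rmu)
  (compact_restr_inner_regular hX cA rmu)
  (compact_restr_inner_regular hX cB rmu) F F0 mF.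
have iB x : (\int[compact_restr hX cB rmu]_y F (x, y) =
    \int[mu]_(y in B) F (x, y))%E by exact: integral_compact_restr.
have iA y : (\int[compact_restr hX cA rmu]_x F (x, y) =
    \int[mu]_(x in A) F (x, y))%E by exact: integral_compact_restr.
have eB : (fun x => \int[compact_restr hX cB rmu]_y F (x, y))%E =
    (fun x => \int[mu]_(y in B) F (x, y))%E by exact/funext.
have eA : (fun y => \int[compact_restr hX cA rmu]_x F (x, y))%E =
    (fun y => \int[mu]_(x in A) F (x, y))%E by exact/funext.
rewrite eA in my *; rewrite eB in mx *; rewrite !integral_compact_restr//.
- by move=> y; exact: integral_ge0.
- by move=> x; exact: integral_ge0.
Qed.

(** * Topological groups and Haar measure *)

Section group_topology.
Context (G : topologicalGroupType).
Implicit Types (x y : G) (A B : set G).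

Definition mulset A B := [set (x * y)%g | x in A & y in B].

Lemma mulset_mem A B x y : A x -> B y -> mulset A B (x * y)%g.
Proof. by move=> Ax By; exists x => //; exists y. Qed.

Lemma continuous_mulg (T : topologicalType) (f g : T -> G) :
  continuous f -> continuous g -> continuous (fun t => (f t * g t)%g).
Proof.
move=> cf cg t; apply: (@continuous_comp _ _ _ (fun t => (f t, g t))
  (fun p : G * G => (p.1 * p.2)%g)); last exact: mulg_continuous.
by apply: cvg_pair; [exact: cf|exact: cg].
Qed.

Lemma continuous_invg (T : topologicalType) (f : T -> G) :
  continuous f -> continuous (fun t => ((f t)^-1)%g).
Proof.
by move=> cf t; apply: continuous_comp; [exact: cf|exact: invg_continuous].
Qed.

Lemma continuous_mulgl x : continuous (fun y => (x * y)%g).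
Proof.
by apply: continuous_mulg; [exact: cst_continuous|move=> t; exact: cvg_id].
Qed.

Lemma continuous_mulgr x : continuous (fun y => (y * x)%g).
Proof.
by apply: continuous_mulg; [move=> t; exact: cvg_id|exact: cst_continuous].
Qed.

Lemma compact_image (f : G -> G) A :
  continuous f -> compact A -> compact (f @` A).
Proof. by move=> cf; apply: continuous_compact; exact: continuous_subspaceT. Qed.

Lemma compact_mulset A B : compact A -> compact B -> compact (mulset A B).
Proof.
move=> cA cB.
have -> : mulset A B = (fun p : G * G => (p.1 * p.2)%g) @` (A `*` B).
  apply/seteqP; split => [_ [x Ax [y By] <-]|_ [[x y] [/= Ax By] <-]].
    by exists (x, y).
  exact: mulset_mem.
apply: continuous_compact; last exact: compact_setX.
exact/continuous_subspaceT/mulg_continuous.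
Qed.

Lemma image_mulgl x A : (fun y => (x * y)%g) @` A = (fun y => (x^-1 * y)%g) @^-1` A.
Proof.
apply/seteqP; split => [_ [y Ay <-]|y Ay] /=; first by rewrite mulKg.
by exists (x^-1 * y)%g; rewrite ?mulVKg.
Qed.

Lemma nbhs_mulgl x y A : nbhs (x^-1 * y)%g A -> nbhs y ((fun y => (x * y)%g) @` A).
Proof. by move=> Ay; rewrite image_mulgl; exact: continuous_mulgl. Qed.

Lemma nbhs_mulgr x y A : nbhs (y * x^-1)%g A -> nbhs y ((fun y => (y * x)%g) @` A).
Proof.
move=> /(@continuous_mulgr (x^-1)%g y A) nA.
apply: (@filterS _ (nbhs y) _ _ _ _ nA) => z Az.
by exists (z * x^-1)%g => //; rewrite mulgVK.
Qed.

Lemma locally_compact_nbhs1 : locally_compact [set: G] ->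
  exists2 V : set G, compact V & nbhs 1%g V.
Proof.
move=> /(_ 1%g I)[V nV [cV _]]; exists V => //.
by apply: (@filterS _ (nbhs _) _ _ _ _ nV) => x; exact.
Qed.

Lemma nbhs_mulset x A : nbhs 1%g A -> nbhs x (mulset [set x] A).
Proof.
move=> nA; have : nbhs x ((fun y => (x * y)%g) @` A).
  by apply: nbhs_mulgl; rewrite mulVg.
by apply: filterS => _ [y Ay <-]; exact: mulset_mem.
Qed.

End group_topology.

Section haar.
Local Open Scope ereal_scope.
Context (R : realType) (G : topologicalGroupType) (hG : hausdorff_space G).
Variable mu : {measure set (borel G) -> \bar R}.
Hypothesis hmu : left_haar_measure mu.

Let rmu := haar_radon hmu.

Lemma haar_preimage x (A : set (borel G)) : measurable A ->
  mu ((fun y : G => (x^-1 * y)%g) @^-1` A) = mu A.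
Proof. by move=> mA; rewrite -image_mulgl; exact: (haar_left_invariant hmu). Qed.

Lemma haar_integral x (f : borel G -> \bar R) :
  (forall z, 0 <= f z) -> measurable_fun setT f ->
  \int[mu]_y f (x^-1 * y)%g = \int[mu]_y f y.
Proof.
move=> f0 mf.
have mx := borel_continuous (@continuous_mulgl G (x^-1)%g).
have := @ge0_integral_pushforward _ _ _ _ R _ mx mu setT f measurableT mf.
rewrite preimage_setT => <- //.
by apply: eq_measure_integral => A mA _; exact: haar_preimage.
Qed.

Lemma radon_null (A : set (borel G)) : measurable A ->
  (forall K : set G, compact K -> K `<=` A -> mu K = 0) -> mu A = 0.
Proof.
move=> mA A0; apply/eqP; rewrite eq_le measure_ge0 andbT.
rewrite (radon_inner_regular rmu mA); apply: ge_ereal_sup => _ [K [cK KA] <-].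
by rewrite A0.
Qed.

(** If U were null, every compact set, being covered by finitely many
    translates of U, would be null, and so would be every Borel set. *)
Lemma haar_open_gt0 (U : set G) x : open U -> U x -> 0 < mu U.
Proof.
move=> oU Ux; rewrite lt0e measure_ge0 andbT; apply/negP => /eqP U0.
have [A mA /negP] := haar_neq0 hmu; apply; apply/eqP.
have mU : measurable (U : set (borel G)) by exact: borel_open.
apply: radon_null => // K; rewrite compact_cover => cK _.
pose V (z : G) : set G := (fun y => ((z * x^-1) * y)%g) @` U.
have oV z : open (V z).
  rewrite /V image_mulgl; move/continuousP : (@continuous_mulgl G (z * x^-1)^-1%g).
  exact.
have [D _ KD] : finite_subset_cover K V K.
  apply: cK => [z _|z Kz]; first exact: oV.
  by exists z => //; exists x => //; rewrite mulgVK.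
have mV z : measurable (V z : set (borel G)) by exact: borel_open.
have V0 z : mu (V z) = 0 by rewrite -U0; exact: (haar_left_invariant hmu).
have [mD D0] : measurable (\bigcup_(z in [set` D]) V z : set (borel G)) /\
    mu (\bigcup_(z in [set` D]) V z) = 0.
  rewrite bigcup_fset.
  elim/big_ind : _ => [|A1 A2 [mA1 A10] [mA2 A20]|z _]; last by [].
    by split; [exact: measurable0|exact: measure0].
  by split; [exact: measurableU|rewrite measureU0].
rewrite -compact_cover in cK.
by apply: (subset_measure0 _ mD KD D0); exact: borel_compact.
Qed.

Lemma haar_nbhs_gt0 (V : set G) (x : G) : measurable (V : set (borel G)) ->
  nbhs x V -> 0 < mu V.
Proof.
move=> mV; rewrite nbhsE => -[U [oU Ux] UV].
apply: lt_le_trans (haar_open_gt0 oU Ux) _.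
by apply: le_measure; rewrite ?inE//; exact: borel_open.
Qed.

Lemma measurable_quotient :
  measurable_fun setT (fun z : borel (G * G)%type => (z.1^-1 * z.2)%g : borel G).
Proof.
apply: (@borel_continuous (G * G)%type G (fun z => (z.1^-1 * z.2)%g)).
apply: continuous_mulg; first apply: continuous_invg.
- by move=> z; exact: cvg_fst.
- by move=> z; exact: cvg_snd.
Qed.

(** Inversion preserves null sets. By inner regularity it suffices that a compact
    set C is null if D = C^-1 is. For a compact neighbourhood V of 1, integrate
    the indicator of D at y^-1 x over x in V and y in V C: integrating over x
    first gives 0, as y D is null, and integrating over y first gives
    mu(C) mu(V), as x C lies in V C; and mu(V) > 0. *)
Lemma haar_preimage_inv (N : set (borel G)) : locally_compact [set: G] ->
  measurable N -> mu N = 0 -> mu ((fun x : G => x^-1%g) @^-1` N) = 0.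
Proof.
move=> lG mN N0.
have minv := borel_continuous (@invg_continuous G).
apply: radon_null => [|C cC CN].
  by rewrite -[X in measurable X]setTI; exact: minv.
have [V cV nV] := locally_compact_nbhs1 lG.
have mV := borel_compact hG cV; have mC := borel_compact hG cC.
pose D : set G := (fun x : G => x^-1%g) @` C.
have cD : compact D by apply: compact_image => //; exact: invg_continuous.
have mD := borel_compact hG cD.
have D0 : mu D = 0.
  by apply: subset_measure0 N0 => // _ [x Cx <-]; exact: CN.
pose F (z : borel (G * G)%type) : \bar R := (\1_D (z.1^-1 * z.2)%g)%:E.
have cVC := compact_mulset cV cC.
have mVC := borel_compact hG cVC.
have mF : measurable_fun setT F.
  apply/measurable_EFinP; apply: measurableT_comp measurable_quotient.
  exact: measurable_indic.
have F0 z : 0 <= F z by rewrite lee_fin.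
have [_ _] := radon_tonelli hG rmu cVC cV F0 mF.
(* Integrating over x first: the section at y is part of the null set y D. *)
rewrite integral0_eq => [|y _]; last first.
  rewrite (@eq_integral _ _ _ mu V
    (EFin \o \1_((fun x : G => (y^-1 * x)%g) @^-1` D)))//.
  have mDy : measurable ((fun x : G => (y^-1 * x)%g) @^-1` D : set (borel G)).
    rewrite -[X in measurable X]setTI.
    exact: (borel_continuous (@continuous_mulgl G (y^-1)%g)).
  rewrite integral_indic//; apply: (@subset_measure0 _ _ _ mu _ _ _ mDy) => //.
    exact: measurableI.
  exact: etrans (haar_preimage y mD) D0.
rewrite (eq_integral (cst (mu C))) => [|x /set_mem Vx].
  rewrite integral_cst// => /esym/eqP; rewrite mule_eq0 => /orP[/eqP //|].
  by rewrite gt_eqF// (haar_nbhs_gt0 mV nV).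
(* Integrating over y first: for x in V the section is x C, inside V C. *)
pose xC := (fun y : G => (x * y)%g) @` C.
have mxC : measurable (xC : set (borel G)).
  exact: (borel_compact hG (compact_image (@continuous_mulgl G x) cC)).
rewrite (@eq_integral _ _ _ mu _ (EFin \o \1_xC)) => [|y _]; last first.
  rewrite /F/= !indicE (_ : (_ \in D) = (y \in xC))//; apply/idP/idP; rewrite !inE.
    move=> [z Cz zxy]; exists z => //; rewrite -[z]invgK zxy invgM invgK mulgA.
    by rewrite mulgV mul1g.
  by move=> [z Cz <-]; exists z => //=; rewrite invgM mulgVK.
rewrite integral_indic// setIidl.
  exact: (haar_left_invariant hmu).
by move=> _ [z Cz <-]; exact: mulset_mem.
Qed.

End haar.

(** * Convolution of functions *)

Lemma integral_support d (T : measurableType d) (R : realType)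
    (mu : {measure set T -> \bar R}) (A : set T) (f : T -> \bar R) :
  (forall x, ~ A x -> f x = 0%E) ->
  (\int[mu]_(x in A) f x = \int[mu]_x f x)%E.
Proof.
move=> f0; rewrite integral_mkcond; apply: eq_integral => x _.
by rewrite patchE; case: ifPn => // /negP; rewrite inE => /f0.
Qed.

Section convolution_functions.
Local Open Scope ereal_scope.
Context (R : realType) (G : topologicalGroupType) (hG : hausdorff_space G).
Variable mu : {measure set (borel G) -> \bar R}.
Hypothesis hmu : left_haar_measure mu.
Variables (u v : borel G -> R) (K L : set G).
Hypothesis (mu_ : measurable_fun setT u) (mv_ : measurable_fun setT v).
Hypothesis (cK : compact K) (cL : compact L).
Hypothesis (u0 : forall x, ~ K x -> u x = 0%R) (v0 : forall x, ~ L x -> v x = 0%R).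

Let rmu := haar_radon hmu.
Let cKL := compact_mulset cK cL.

Definition conv_integrand (x y : borel G) : R := (u y * v ((y : G)^-1 * x)%g)%R.

Definition conv (x : borel G) : R := (\int[mu]_y conv_integrand x y)%R.

Lemma measurable_conv_integrand x : measurable_fun setT (conv_integrand x).
Proof.
apply: measurable_funM => //; apply: (measurableT_comp mv_).
apply: (@borel_continuous G G (fun y => (y^-1 * x)%g)).
by apply: continuous_mulg; [exact: invg_continuous|exact: cst_continuous].
Qed.

Lemma conv_integrand0 x y : ~ mulset K L x \/ ~ K y -> conv_integrand x y = 0%R.
Proof.
rewrite /conv_integrand; have [Ky|nKy] := pselect (K y); last by rewrite u0// mul0r.
case=> // nx; rewrite v0 ?mulr0// => Lyx; apply: nx.
by exists y => //; exists (y^-1 * x)%g => //; rewrite mulVKg.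
Qed.

Section tonelli.
Variable h : R -> R.
Hypothesis (mh : measurable_fun setT h) (h0 : h 0%R = 0%R)
  (hge0 : forall r, (0 <= h r)%R).

Let F (z : borel (G * G)%type) : \bar R := (h (conv_integrand z.2 z.1))%:E.

Let mF : measurable_fun setT F.
Proof.
apply/measurable_EFinP; apply: (measurableT_comp mh).
apply: measurable_funM.
  apply: (measurableT_comp mu_ (borel_continuous (f := @fst G G) _)).
  by move=> z; exact: cvg_fst.
exact: (measurableT_comp mv_ (@measurable_quotient G)).
Qed.

Let F_ge0 z : 0 <= F z. Proof. by rewrite lee_fin. Qed.

Let T := radon_tonelli hG rmu cK cKL F_ge0 mF.

Let suppK x : \int[mu]_(y in K) (h (conv_integrand x y))%:E =
  \int[mu]_y (h (conv_integrand x y))%:E.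
Proof.
apply: integral_support => y nKy; rewrite conv_integrand0 ?h0//; by right.
Qed.

Lemma measurable_conv_section :
  measurable_fun setT (fun x => \int[mu]_y (h (conv_integrand x y))%:E).
Proof.
have [_ + _] := T.
rewrite (_ : (fun _ => _) =
  (fun x => \int[mu]_y (h (conv_integrand x y))%:E))//.
by apply/funext => x; exact: suppK.
Qed.

(** The integrand lives on y in K and x in K L, so that Tonelli's theorem is only
    used on compact sets. Here [h] stands for the norm, the positive part
    or the negative part. *)
Lemma tonelli_conv : \int[mu]_x \int[mu]_y (h (conv_integrand x y))%:E =
  \int[mu]_(y in K) \int[mu]_x (h (conv_integrand x y))%:E.
Proof.
have [_ _] := T => TE.
transitivity (\int[mu]_(x in mulset K L) \int[mu]_(y in K) (h (conv_integrand x y))%:E).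
  rewrite [RHS]integral_support.
    by apply: eq_integral => x _; rewrite suppK.
  move=> x nx; rewrite integral0_eq// => y _; rewrite conv_integrand0 ?h0//.
  by left.
rewrite -[LHS]TE; apply: eq_integral => y /set_mem Ky.
apply: integral_support => x nx; rewrite /F conv_integrand0 ?h0//; by left.
Qed.

End tonelli.

Local Notation Phi x := (\int[mu]_y `|conv_integrand x y|%:E).

Lemma integral_norm_conv :
  \int[mu]_x Phi x = (\int[mu]_x `|u x|%:E) * (\int[mu]_x `|v x|%:E).
Proof.
rewrite tonelli_conv ?normr0//.
have mnu : measurable_fun setT (fun x => `|u x|%:E).
  by apply/measurable_EFinP; exact: measurableT_comp.
have mnv : measurable_fun setT (fun x => `|v x|%:E).
  by apply/measurable_EFinP; exact: measurableT_comp.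
have I0 : 0 <= \int[mu]_x `|v x|%:E by apply: integral_ge0.
rewrite (@integral_support _ _ _ mu K) => [|y nKy]; last first.
  rewrite integral0_eq// => x _; rewrite conv_integrand0 ?normr0//; by right.
rewrite muleC -ge0_integralZl//.
apply: eq_integral => y _.
under eq_integral do rewrite normrM EFinM.
rewrite ge0_integralZl//; first rewrite muleC.
  by congr (_ * _); exact: (haar_integral hmu y (f := fun z => `|v z|%:E)).
apply: (measurableT_comp mnv).
exact: (borel_continuous (@continuous_mulgl G (y : G)^-1%g)).
Qed.

Hypothesis (iu : mu.-integrable setT (EFin \o u))
  (iv : mu.-integrable setT (EFin \o v)).

(** The integral over x of the integral over y of the norm is |u| |v|, hence
    finite; so the inner integral is finite for almost every x. *)
Lemma ae_conv_integrable :
  {ae mu, forall x, mu.-integrable setT (EFin \o conv_integrand x)}.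
Proof.
have mPhi : measurable_fun setT (fun x => Phi x).
  by apply: (@measurable_conv_section (@Num.norm _ R)) => //; exact: normr0.
have : mu.-integrable setT (fun x => Phi x).
  apply/integrableP; split => //.
  under eq_integral do rewrite gee0_abs ?integral_ge0//.
  rewrite integral_norm_conv.
  move/integrableP : iu => [_ +]; move/integrableP : iv => [_ +].
  move=> ? ?; apply: lte_mul_pinfty => //; first exact: integral_ge0.
  by rewrite ge0_fin_numE ?integral_ge0.
move=> /(integrable_ae measurableT); apply: filterS => x /(_ I) Px.
apply/integrableP; split.
  by apply/measurable_EFinP; exact: measurable_conv_integrand.
by rewrite /= -ge0_fin_numE ?integral_ge0.
Qed.

(** The positive and negative parts of the integrand are handled separately,
    since measurability in x comes from Tonelli's theorem, which is about
    nonnegative integrands. *)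
Lemma measurable_conv : measurable_fun setT conv.
Proof.
have -> : conv = fine \o (fun x => \int[mu]_y (Num.max (conv_integrand x y) 0)%:E -
                       \int[mu]_y (Num.max (- conv_integrand x y) 0)%:E).
  apply/funext => x; rewrite /= /conv /Rintegral integralE.
  by congr (fine (_ - _)); apply: eq_integral => y _;
    rewrite ?funeposE ?funenegE -?EFinN EFin_max.
apply: measurableT_comp => //; apply: emeasurable_funB.
- apply: (@measurable_conv_section (fun r => Num.max r 0)%R).
  + exact: measurable_maxr.
  + by rewrite maxxx.
  + by move=> r; rewrite le_max lexx orbT.
- apply: (@measurable_conv_section (fun r => Num.max (- r) 0)%R).
  + by apply: measurable_maxr => //; exact: measurable_funN.
  + by rewrite oppr0 maxxx.
  + by move=> r; rewrite le_max lexx orbT.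
Qed.

Lemma norm_conv_le x : `|conv x|%:E <= Phi x.
Proof.
have [Px|] := ltP (Phi x) +oo; last by rewrite leye_eq => /eqP ->; rewrite leey.
have ix : mu.-integrable setT (EFin \o conv_integrand x).
  apply/integrableP; split=> //.
  by apply/measurable_EFinP; exact: measurable_conv_integrand.
have := le_normr_Rintegral measurableT ix.
rewrite -lee_fin => /le_trans; apply; rewrite /Rintegral fineK//.
by rewrite ge0_fin_numE ?integral_ge0.
Qed.

Lemma integral_conv_le :
  \int[mu]_x `|conv x|%:E <= (\int[mu]_x `|u x|%:E) * (\int[mu]_x `|v x|%:E).
Proof.
rewrite -integral_norm_conv; apply: ge0_le_integral => //.
- by apply/measurable_EFinP; apply: measurableT_comp => //; exact: measurable_conv.
- by apply: (@measurable_conv_section (@Num.norm _ R)) => //; exact: normr0.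
- by move=> x _; exact: norm_conv_le.
Qed.

Lemma conv_integrable : mu.-integrable setT (EFin \o conv).
Proof.
apply/integrableP; split; first by apply/measurable_EFinP; exact: measurable_conv.
apply: le_lt_trans integral_conv_le _.
move/integrableP : iu => [_ +]; move/integrableP : iv => [_ +].
move=> ? ?; apply: lte_mul_pinfty => //; first exact: integral_ge0.
by rewrite ge0_fin_numE ?integral_ge0.
Qed.

Lemma conv_support x : ~ mulset K L x -> conv x = 0%R.
Proof.
move=> nx; rewrite /conv /Rintegral integral0_eq// => y _.
by rewrite conv_integrand0//; left.
Qed.

Lemma integral_conv_ge0 : (forall x, 0 <= u x)%R -> (forall x, 0 <= v x)%R ->
  \int[mu]_x `|conv x|%:E = (\int[mu]_x `|u x|%:E) * (\int[mu]_x `|v x|%:E).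
Proof.
move=> uge0 vge0; rewrite -integral_norm_conv; apply: ge0_ae_eq_integral => //.
- by apply/measurable_EFinP; apply: measurableT_comp => //; exact: measurable_conv.
- by apply: (@measurable_conv_section (@Num.norm _ R)) => //; exact: normr0.
- by move=> x _; exact: integral_ge0.
apply: filterS ae_conv_integrable => x /integrableP[_ ix] _.
have i0 y : (0 <= conv_integrand x y)%R by exact: mulr_ge0.
rewrite ger0_norm ?Rintegral_ge0// /conv /Rintegral fineK.
  by apply: eq_integral => y _; rewrite ger0_norm.
rewrite ge0_fin_numE; last by apply: integral_ge0 => y _; rewrite lee_fin.
by under eq_integral do rewrite -[conv_integrand _ _]ger0_norm//.
Qed.

End convolution_functions.

(** * Classes of integrable functions with compact support *)

Section L1c_theory.
Context (R : realType) (X : ptopologicalType).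
Variable mu : {measure set (borel X) -> \bar R}.
Implicit Types (f g : L1c mu) (K : set X).

Definition nrm1 f : R := `|L1c_val f|.

Lemma L1c_ae f g : (\forall x \ae mu, f x = g x) -> f = g.
Proof. by move=> fg; do 2!apply: val_inj; exact: ae_inj. Qed.

Lemma L1c_val0 : L1c_val (0 : L1c mu) = 0.
Proof. by rewrite -[LHS]/(\val (0 : L1c mu)) raddf0. Qed.

Lemma L1c_valD f g : L1c_val (f + g) = L1c_val f + L1c_val g.
Proof. by rewrite -[LHS]/(\val (f + g)) raddfD. Qed.

Lemma L1c_valZ a f : L1c_val (a *: f) = a *: L1c_val f.
Proof. by rewrite -[LHS]/(\val (a *: f)) linearZ. Qed.

Lemma L1c_0E : \forall x \ae mu, (0 : L1c mu) x = 0.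
Proof. by rewrite L1c_val0; exact: ae_zeroE. Qed.

Lemma L1c_addE f g : \forall x \ae mu, (f + g) x = f x + g x.
Proof. by rewrite L1c_valD; exact: ae_addE. Qed.

Lemma L1c_scaleE a f : \forall x \ae mu, (a *: f) x = a * f x.
Proof. by rewrite L1c_valZ; exact: ae_scaleE. Qed.

Lemma measurable_L1c f : measurable_fun setT (f : borel X -> R).
Proof. exact: measurable_ae. Qed.

Lemma nrm1E f : (nrm1 f)%:E = (\int[mu]_x `|f x|%:E)%E.
Proof. by rewrite -[nrm1 f]/(L1norm (L1c_val f)) L1normE Lnorm1. Qed.

Lemma L1c_integrable f : mu.-integrable setT (EFin \o f).
Proof.
apply/integrableP; split; first by apply/measurable_EFinP; exact: measurable_L1c.
by rewrite /= -nrm1E ltry.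
Qed.

Lemma nrm1_ae f (u : borel X -> R) : measurable_fun setT u ->
  (\forall x \ae mu, f x = u x) -> (nrm1 f)%:E = (\int[mu]_x `|u x|%:E)%E.
Proof.
move=> mu_ fu; rewrite nrm1E; apply: ge0_ae_eq_integral => //.
- by apply/measurable_EFinP; apply: measurableT_comp => //; exact: measurable_L1c.
- by apply/measurable_EFinP; exact: measurableT_comp.
- by apply: filterS fu => x -> _.
Qed.

Lemma nrm1_ge0 f : 0 <= nrm1 f. Proof. exact: normr_ge0. Qed.

Lemma nrm1_0 : nrm1 0 = 0. Proof. by rewrite /nrm1 L1c_val0 normr0. Qed.

Lemma nrm1_eq0 f : nrm1 f = 0 -> f = 0.
Proof.
by move=> /normr0_eq0 f0; apply: val_inj; rewrite [LHS]f0 -L1c_val0.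
Qed.

Lemma nrm1D f g : nrm1 (f + g) <= nrm1 f + nrm1 g.
Proof. by rewrite /nrm1 L1c_valD ler_normD. Qed.

Lemma nrm1Z a f : nrm1 (a *: f) = `|a| * nrm1 f.
Proof. by rewrite /nrm1 L1c_valZ normrZ. Qed.

Lemma L1c_support f : exists2 K, compact K & L1K K f.
Proof. by have /asboolP := L1c_valP f. Qed.

Lemma L1c_exists (u : borel X -> R) K : mu.-integrable setT (EFin \o u) ->
  compact K -> {ae mu, forall x, ~ K x -> u x = 0} ->
  exists2 f : L1c mu, (\forall x \ae mu, f x = u x) & L1K K f.
Proof.
move=> /integrableP[/measurable_EFinP mu_ iu] cK u0.
have fu := ae_classE mu mu_.
have fin : ae_class mu mu_ \in @finL1 _ _ _ mu.
  apply/asboolP; rewrite /finite_norm Lnorm1.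
  rewrite (@ge0_ae_eq_integral _ _ _ mu setT _ (fun x => `|u x|%:E))//.
  - by apply/measurable_EFinP; apply: measurableT_comp => //; exact: measurable_ae.
  - by apply/measurable_EFinP; exact: measurableT_comp.
  - by apply: filterS fu => x /= -> _.
pose f1 : LspaceType1 mu := L1_Sub fin.
have Kf : L1K K f1.
  by apply: filterS2 fu u0 => x /= fx u0 /u0; rewrite -fx.
have fc : f1 \in @L1c_pred _ _ mu by apply/asboolP; exists K.
by exists (MkL1c fc).
Qed.

End L1c_theory.

(** * Convolution of classes *)

Section convolution_classes.
Context (R : realType) (G : topologicalGroupType) (hG : hausdorff_space G)
  (lG : locally_compact [set: G]).
Variable mu : {measure set (borel G) -> \bar R}.
Hypothesis hmu : left_haar_measure mu.
Implicit Types (f g h : L1c mu) (u v : borel G -> R) (K L : set G).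

(** The exceptional set of y is x N^-1 when N is the exceptional set of P. This
    is what makes y |-> g(y^-1 x) well defined up to null sets for a class g and
    every x, even though mu need not be sigma-finite. *)
Lemma ae_inv_translate (P : G -> Prop) (x : G) : {ae mu, forall z, P z} ->
  {ae mu, forall y : borel G, P ((y : G)^-1 * x)%g}.
Proof.
move=> [N [mN N0 PN]].
have minv := borel_continuous (@invg_continuous G).
have mN' : measurable ((fun z : G => z^-1%g) @^-1` N : set (borel G)).
  by rewrite -[X in measurable X]setTI; exact: minv.
exists ((fun y : G => (x^-1 * y)%g) @^-1` ((fun z : G => z^-1%g) @^-1` N)); split.
- rewrite -[X in measurable X]setTI.
  exact: (borel_continuous (@continuous_mulgl G (x^-1)%g)).
- exact: etrans (haar_preimage hmu x mN') (haar_preimage_inv hG hmu lG mN N0).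
- by move=> y /= nP; apply: PN => /= Py; apply: nP; move: Py; rewrite invgM invgK.
Qed.

Lemma conv_integrand_ae u u' v v' x :
  {ae mu, forall y, u y = u' y} -> {ae mu, forall y, v y = v' y} ->
  {ae mu, forall y, conv_integrand u v x y = conv_integrand u' v' x y}.
Proof.
move=> uu' /(@ae_inv_translate (fun z : G => v z = v' z) x).
by apply: filterS2 uu' => y; rewrite /conv_integrand => -> ->.
Qed.

(** [is_convolution] for functions instead of classes, so that representatives
    can be exchanged. *)
Definition is_conv u v (h : borel G -> R) := {ae mu, forall x : borel G,
  mu.-integrable setT (EFin \o conv_integrand u v x) /\ h x = conv mu u v x}.

Lemma is_conv_ae u u' v v' h : measurable_fun setT u -> measurable_fun setT u' ->
  measurable_fun setT v -> measurable_fun setT v' ->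
  {ae mu, forall y, u y = u' y} -> {ae mu, forall y, v y = v' y} ->
  is_conv u v h -> is_conv u' v' h.
Proof.
move=> m_u mu' mv mv' uu' vv'; apply: filterS => x [iuv ->].
have mE := measurable_conv_integrand m_u mv x.
have mE' := measurable_conv_integrand mu' mv' x.
have uv := conv_integrand_ae x uu' vv'.
split.
  move/integrableP : iuv => [_ iuv].
  apply/integrableP; split; first exact/measurable_EFinP.
  rewrite (@ge0_ae_eq_integral _ _ _ mu setT _
    (fun y => `|conv_integrand u v x y|%:E))//.
  - by apply/measurable_EFinP; exact: measurableT_comp.
  - by apply/measurable_EFinP; exact: measurableT_comp.
  - by apply: filterS uv => y /= ->.
rewrite /conv /Rintegral; congr fine; apply: ae_eq_integral => //.
- exact/measurable_EFinP.
- exact/measurable_EFinP.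
- by apply: filterS uv => y /= ->.
Qed.

(** Tonelli's theorem on compact sets asks for functions that vanish everywhere
    off K, and the equality of norms for functions that are nonnegative
    everywhere. *)
Lemma L1K_representative f K : compact K -> L1K K f ->
  exists u : borel G -> R, [/\ measurable_fun setT u,
    mu.-integrable setT (EFin \o u), (forall x, ~ K x -> u x = 0),
    {ae mu, forall x, f x = u x} &
    {ae mu, forall x, 0 <= f x} -> forall x, 0 <= u x].
Proof.
move=> cK Kf; have mK := borel_compact hG cK.
have mf := measurable_L1c f.
suff [u [m_u u0 fu upos]] : exists u : borel G -> R, [/\ measurable_fun setT u,
    (forall x, ~ K x -> u x = 0), {ae mu, forall x, f x = u x} &
    {ae mu, forall x, 0 <= f x} -> forall x, 0 <= u x].
  exists u; split => //; apply/integrableP; split; first exact/measurable_EFinP.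
  by rewrite -(nrm1_ae m_u fu) ltry.
have [fpos|nfpos] := pselect {ae mu, forall x, 0 <= f x}.
  exists (fun x => `|f x| * \1_K x); split.
  - by apply: measurable_funM; [exact: measurableT_comp|exact: measurable_indic].
  - by move=> x nKx; rewrite indicE memNset// mulr0.
  - apply: filterS2 Kf fpos => x Kfx fx.
    rewrite ger0_norm// indicE; have [Kx|nKx] := pselect (K x).
      by rewrite mem_set// mulr1.
    by rewrite (Kfx nKx) mul0r.
  - by move=> _ x; rewrite mulr_ge0.
exists (fun x => f x * \1_K x); split => //.
- by apply: measurable_funM => //; exact: measurable_indic.
- by move=> x nKx; rewrite indicE memNset// mulr0.
- apply: filterS Kf => x Kfx; rewrite indicE; have [Kx|nKx] := pselect (K x).
    by rewrite mem_set// mulr1.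
  by rewrite (Kfx nKx) mul0r.
Qed.

Lemma convolution_exists f g K L : compact K -> compact L ->
  L1K K f -> L1K L g -> exists h, [/\ is_convolution f g h,
    L1K (mulset K L) h, nrm1 h <= nrm1 f * nrm1 g &
    {ae mu, forall x, 0 <= f x} -> {ae mu, forall x, 0 <= g x} ->
      nrm1 h = nrm1 f * nrm1 g].
Proof.
move=> cK cL /(L1K_representative cK)[u [m_u iu u0 fu upos]].
move=> /(L1K_representative cL)[v [mv iv v0 gv vpos]].
have iconv := conv_integrable hG hmu m_u mv cK cL u0 v0 iu iv.
have sconv : {ae mu, forall x, ~ mulset K L x -> conv mu u v x = 0}.
  by apply: aeW => x; exact: conv_support.
have [h hconv Kh] := L1c_exists iconv (compact_mulset cK cL) sconv.
have mconv := measurable_conv hG hmu m_u mv cK cL u0 v0.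
exists h; split => //.
- apply: (@is_conv_ae u f v g) => //; try exact: measurable_L1c.
  + by apply: filterS fu => x ->.
  + by apply: filterS gv => x ->.
  have := ae_conv_integrable hG hmu m_u mv cK cL u0 v0 iu iv.
  by apply: filterS2 hconv => x hx ix; split.
- rewrite -lee_fin EFinM (nrm1_ae mconv hconv) (nrm1_ae m_u fu) (nrm1_ae mv gv).
  exact: (integral_conv_le hG hmu m_u mv cK cL u0 v0).
- move=> fpos gpos; apply: EFin_inj.
  rewrite EFinM (nrm1_ae mconv hconv) (nrm1_ae m_u fu) (nrm1_ae mv gv).
  exact: (integral_conv_ge0 hG hmu m_u mv cK cL u0 v0 iu iv (upos fpos) (vpos gpos)).
Qed.

Lemma convolutionP f g : is_convolution f g (convolution f g).
Proof.
have [K cK Kf] := L1c_support f; have [L cL Lg] := L1c_support g.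
have [h [fgh _ _ _]] := convolution_exists cK cL Kf Lg.
by rewrite /convolution; case: xgetP => // /(_ h).
Qed.

Lemma convolution_eq f g h : is_convolution f g h -> convolution f g = h.
Proof. by move=> fgh; exact: is_convolution_unique (convolutionP f g) fgh. Qed.

Lemma convolution_support f g K L : compact K -> compact L ->
  L1K K f -> L1K L g -> L1K (mulset K L) (convolution f g).
Proof.
move=> cK cL Kf Lg; have [h [fgh Kh _ _]] := convolution_exists cK cL Kf Lg.
by rewrite (convolution_eq fgh).
Qed.

Lemma nrm1_convolution f g : nrm1 (convolution f g) <= nrm1 f * nrm1 g.
Proof.
have [K cK Kf] := L1c_support f; have [L cL Lg] := L1c_support g.
have [h [fgh _ + _]] := convolution_exists cK cL Kf Lg.
by rewrite (convolution_eq fgh).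
Qed.

Lemma nrm1_convolution_ge0 f g :
  {ae mu, forall x, 0 <= f x} -> {ae mu, forall x, 0 <= g x} ->
  nrm1 (convolution f g) = nrm1 f * nrm1 g.
Proof.
have [K cK Kf] := L1c_support f; have [L cL Lg] := L1c_support g.
have [h [fgh _ _ +]] := convolution_exists cK cL Kf Lg.
by rewrite (convolution_eq fgh).
Qed.

Lemma convolutionDl f f' g :
  convolution (f + f') g = convolution f g + convolution f' g.
Proof.
apply: convolution_eq.
apply: (@is_conv_ae (fun y => f y + f' y) _ g); try exact: measurable_L1c.
- by apply: measurable_funD; exact: measurable_L1c.
- by apply: filterS (L1c_addE f f') => y ->.
- exact: aeW.
move: (convolutionP f g) (convolutionP f' g)
  (L1c_addE (convolution f g) (convolution f' g)).
apply: filterS3 => x [i1 e1] [i2 e2] ->.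
have E y : conv_integrand (fun y0 => f y0 + f' y0) g x y =
  conv_integrand f g x y + conv_integrand f' g x y by rewrite /conv_integrand mulrDl.
split; last by rewrite e1 e2 -RintegralD//; apply: eq_Rintegral => y _; rewrite -E.
by apply: eq_integrable (integrableD measurableT i1 i2) => // y _; rewrite /= E.
Qed.

Lemma convolutionDr f g g' :
  convolution f (g + g') = convolution f g + convolution f g'.
Proof.
apply: convolution_eq.
apply: (@is_conv_ae f _ (fun y => g y + g' y)); try exact: measurable_L1c.
- by apply: measurable_funD; exact: measurable_L1c.
- exact: aeW.
- by apply: filterS (L1c_addE g g') => y ->.
move: (convolutionP f g) (convolutionP f g')
  (L1c_addE (convolution f g) (convolution f g')).
apply: filterS3 => x [i1 e1] [i2 e2] ->.
have E y : conv_integrand f (fun y0 => g y0 + g' y0) x y =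
  conv_integrand f g x y + conv_integrand f g' x y by rewrite /conv_integrand mulrDr.
split; last by rewrite e1 e2 -RintegralD//; apply: eq_Rintegral => y _; rewrite -E.
by apply: eq_integrable (integrableD measurableT i1 i2) => // y _; rewrite /= E.
Qed.

Lemma convolutionZl a f g : convolution (a *: f) g = a *: convolution f g.
Proof.
apply: convolution_eq.
apply: (@is_conv_ae (fun y => a * f y) _ g); try exact: measurable_L1c.
- by apply: measurable_funM => //; exact: measurable_L1c.
- by apply: filterS (L1c_scaleE a f) => y ->.
- exact: aeW.
move: (convolutionP f g) (L1c_scaleE a (convolution f g)).
apply: filterS2 => x [i1 e1] ->.
have E y : conv_integrand (fun y0 => a * f y0) g x y =
  a * conv_integrand f g x y by rewrite /conv_integrand mulrA.
split; last by rewrite e1 -RintegralZl//; apply: eq_Rintegral => y _; rewrite -E.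
by apply: eq_integrable (integrableZl measurableT a i1) => // y _; rewrite /= E.
Qed.

Lemma convolutionZr a f g : convolution f (a *: g) = a *: convolution f g.
Proof.
apply: convolution_eq.
apply: (@is_conv_ae f _ (fun y => a * g y)); try exact: measurable_L1c.
- by apply: measurable_funM => //; exact: measurable_L1c.
- exact: aeW.
- by apply: filterS (L1c_scaleE a g) => y ->.
move: (convolutionP f g) (L1c_scaleE a (convolution f g)).
apply: filterS2 => x [i1 e1] ->.
have E y : conv_integrand f (fun y0 => a * g y0) x y =
  a * conv_integrand f g x y by rewrite /conv_integrand mulrCA.
split; last by rewrite e1 -RintegralZl//; apply: eq_Rintegral => y _; rewrite -E.
by apply: eq_integrable (integrableZl measurableT a i1) => // y _; rewrite /= E.
Qed.

End convolution_classes.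

(** * The direct limit topology *)

Section L1c_topology.
Context (R : realType) (X : ptopologicalType).
Variable mu : {measure set (borel X) -> \bar R}.
Implicit Types (f g : L1c mu) (K : set X) (U : set (L1c mu)).

(** Convexity with real coefficients in place of elements of the unit interval
    type. *)
Definition convexR U := forall f g (t : R), 0 <= t -> t <= 1 -> U f -> U g ->
  U (t *: f + (1 - t) *: g).

Lemma lcdlim_nbhs0P U : lcdlim_nbhs0 U <-> convexR U /\
  forall K, compact K -> exists2 e, 0 < e & forall f, L1K K f -> nrm1 f < e -> U f.
Proof.
split => [[cU nU]|[cU nU]]; split.
- move=> f g t t0 t1 Uf Ug; have := cU f g (Itv01 t0 t1).
  by rewrite !inE; exact.
- move=> K /nU /nbhs_ballP[e /= e0 eU]; exists e => // f Kf fe.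
  have [|g Ug gf] := eU (L1c_val f) _ Kf.
    by rewrite -ball_normE/= sub0r normrN.
  by have -> : f = g by exact: val_inj.
- by move=> f g t; rewrite !inE; exact: cU.
- move=> K cK; have [e e0 eU] := nU K cK.
  apply/nbhs_ballP; exists e => //= f; rewrite -ball_normE/= sub0r normrN => fe Kf.
  exists (toL1c f); last exact: toL1cK Kf.
  by apply: eU; rewrite /nrm1 (toL1cK cK Kf).
Qed.

Lemma nbhs0_L1cP (A : set (L1c mu)) :
  nbhs (0 : L1c mu) A <-> exists2 U, lcdlim_nbhs0 U & U `<=` A.
Proof.
split => [[U BU UA]|[U BU UA]].
  by exists U => // u /UA; rewrite add0r.
by exists U => // u /UA; rewrite add0r.
Qed.

Lemma lcdlim_nbhs0_scale U (a : R) : a != 0 -> lcdlim_nbhs0 U ->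
  lcdlim_nbhs0 [set f | U (a *: f)].
Proof.
move=> a0 /lcdlim_nbhs0P[cU nU]; apply/lcdlim_nbhs0P; split.
  move=> f g t t0 t1 /= Uf Ug.
  by rewrite scalerDr !scalerA !(mulrC a) -!scalerA; exact: cU.
move=> K cK; have [e e0 eU] := nU K cK.
exists (e / `|a|); first by rewrite divr_gt0// normr_gt0.
move=> f Kf fe; apply: eU; first by rewrite L1c_valZ; exact: L1KZ.
by rewrite nrm1Z mulrC -ltr_pdivlMr ?normr_gt0.
Qed.

Lemma lcdlim_nbhs0_absorb U f : lcdlim_nbhs0 U -> exists2 r : R, 0 < r & U (r *: f).
Proof.
move=> /lcdlim_nbhs0P[_ nU]; have [K cK Kf] := L1c_support f.
have [e e0 eU] := nU K cK; have n0 : 0 < nrm1 f + 1 by rewrite ltr_wpDl ?nrm1_ge0.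
exists (e / (nrm1 f + 1)); first by rewrite divr_gt0.
apply: eU; first by rewrite L1c_valZ; exact: L1KZ.
rewrite nrm1Z gtr0_norm ?divr_gt0// mulrAC ltr_pdivrMr// ltr_pM2l//.
by rewrite ltrDl.
Qed.

Lemma nbhs_L1c f U : lcdlim_nbhs0 U -> nbhs f [set g | U (g - f)].
Proof. by move=> BU; exists U => //= u Uu; rewrite addrC addKr. Qed.

Lemma convexR_thirds U f g h : convexR U ->
  U (3 *: f) -> U (3 *: g) -> U (3 *: h) -> U (f + (g + h)).
Proof.
move=> cU Uf Ug Uh.
(* The mean of three points, as an iterated convex combination of two. *)
have -> : f + (g + h) = 3^-1 *: (3 *: f) +
    (1 - 3^-1) *: (2^-1 *: (3 *: g) + (1 - 2^-1) *: (3 *: h)).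
  rewrite scalerDr !scalerA; congr (_ + (_ + _)).
  - by rewrite mulVf ?scale1r// pnatr_eq0.
  - by rewrite [X in X *: g](_ : _ = 1) ?scale1r//; field.
  - by rewrite [X in X *: h](_ : _ = 1) ?scale1r//; field.
apply: (cU) => //; rewrite ?invr_ge0// ?invf_le1// ?ler1n//.
by apply: cU => //; rewrite ?invr_ge0// ?invf_le1// ?ler1n.
Qed.

(** Neighbourhoods of 0 absorb points, so joint continuity at 0 yields
    b(f, w) -> 0 and b(w, g) -> 0 as w -> 0, and
    b(f', g') - b(f, g) = b(f, g' - g) + b(f' - f, g) + b(f' - f, g' - g). *)
Lemma bilinear_continuous (b : L1c mu -> L1c mu -> L1c mu) :
  (forall f f' g, b (f + f') g = b f g + b f' g) ->
  (forall f g g', b f (g + g') = b f g + b f g') ->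
  (forall a f g, b (a *: f) g = a *: b f g) ->
  (forall a f g, b f (a *: g) = a *: b f g) ->
  (forall U, lcdlim_nbhs0 U -> exists2 V, lcdlim_nbhs0 V &
     forall f g, V f -> V g -> U (b f g)) ->
  continuous (fun p : L1c mu * L1c mu => b p.1 p.2).
Proof.
move=> bDl bDr bZl bZr b00 [f g] A [U BU UA].
have three0 : 3 != 0 :> R by rewrite pnatr_eq0.
have [V BV VU] := b00 _ (lcdlim_nbhs0_scale three0 BU).
have [/= r r0 Vf] := lcdlim_nbhs0_absorb f BV.
have [/= s s0 Vg] := lcdlim_nbhs0_absorb g BV.
have rV : r^-1 != 0 by rewrite invr_eq0 gt_eqF.
have sV : s^-1 != 0 by rewrite invr_eq0 gt_eqF.
exists ([set f' | V (f' - f)] `&` [set f' | V (s^-1 *: (f' - f))],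
        [set g' | V (g' - g)] `&` [set g' | V (r^-1 *: (g' - g))]).
  split; apply: filterI; try exact: nbhs_L1c.
  - exact: (nbhs_L1c f (lcdlim_nbhs0_scale sV BV)).
  - exact: (nbhs_L1c g (lcdlim_nbhs0_scale rV BV)).
move=> [f' g'] /= [[Vff' Vsf'] [Vgg' Vrg']].
have -> : b f' g' = b f g + (b f (g' - g) + (b (f' - f) g + b (f' - f) (g' - g))).
  rewrite -bDr (addrC g) subrK addrA -bDr (addrC g) subrK.
  by rewrite -bDl (addrC f) subrK.
apply: UA; have [cU _] := (lcdlim_nbhs0P U).1 BU.
apply: (convexR_thirds cU); last exact: VU.
- have -> : b f (g' - g) = b (r *: f) (r^-1 *: (g' - g)).
    by rewrite bZl bZr scalerA mulfV ?scale1r// gt_eqF.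
  exact: VU.
- have -> : b (f' - f) g = b (s^-1 *: (f' - f)) (s *: g).
    by rewrite bZl bZr scalerA mulVf ?scale1r// gt_eqF.
  exact: VU.
Qed.

End L1c_topology.

(** * Cutting classes along Borel sets *)

Section cut.
Context (R : realType) (X : ptopologicalType).
Variable mu : {measure set (borel X) -> \bar R}.
Implicit Types (f g : L1c mu) (A K : set X).

(** The class of f 1_A, which exists for Borel A ([cutE]). *)
Definition cut A f : L1c mu :=
  xget 0 [set c : L1c mu | {ae mu, forall x, c x = f x * \1_A x}].

Section measurable_cut.
Variables (A : set X) (mA : measurable (A : set (borel X))).

Lemma measurable_mul_indic f : measurable_fun setT (fun x : borel X => f x * \1_A x).
Proof.
by apply: measurable_funM; [exact: measurable_L1c|exact: measurable_indic].
Qed.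

Lemma norm_mul_indic f x : `|f x * \1_A x| <= `|f x|.
Proof. by rewrite normrM ler_piMr// indicE normr_nat lern1; case: (_ \in _). Qed.

Lemma cutE f : {ae mu, forall x, cut A f x = f x * \1_A x}.
Proof.
rewrite /cut; case: xgetP => // none.
have [K cK Kf] := L1c_support f.
have [||c cE _] := @L1c_exists _ _ mu (fun x => f x * \1_A x) K _ cK.
- apply: le_integrable (L1c_integrable f) => //.
    by apply/measurable_EFinP; exact: measurable_mul_indic.
  by move=> x _; rewrite /= lee_fin norm_mul_indic.
- by apply: filterS Kf => x fx /fx ->; rewrite mul0r.
by have := none c.
Qed.

Lemma cutD f g : cut A (f + g) = cut A f + cut A g.
Proof.
apply: L1c_ae; near=> x.
have -> : cut A (f + g) x = (f + g) x * \1_A x by near: x; exact: cutE.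
have -> : (f + g) x = f x + g x by near: x; exact: L1c_addE.
have -> : (cut A f + cut A g) x = cut A f x + cut A g x by near: x; exact: L1c_addE.
have -> : cut A f x = f x * \1_A x by near: x; exact: cutE.
have -> : cut A g x = g x * \1_A x by near: x; exact: cutE.
by rewrite mulrDl.
Unshelve. all: by end_near. Qed.

Lemma cutZ a f : cut A (a *: f) = a *: cut A f.
Proof.
apply: L1c_ae; near=> x.
have -> : cut A (a *: f) x = (a *: f) x * \1_A x by near: x; exact: cutE.
have -> : (a *: f) x = a * f x by near: x; exact: L1c_scaleE.
have -> : (a *: cut A f) x = a * cut A f x by near: x; exact: L1c_scaleE.
have -> : cut A f x = f x * \1_A x by near: x; exact: cutE.
by rewrite mulrA.
Unshelve. all: by end_near. Qed.

Lemma nrm1_cut f : nrm1 (cut A f) <= nrm1 f.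
Proof.
rewrite -lee_fin (nrm1_ae (measurable_mul_indic f) (cutE f)) nrm1E.
apply: ge0_le_integral => //.
- apply/measurable_EFinP; apply: measurableT_comp => //; exact: measurable_mul_indic.
- apply/measurable_EFinP; apply: measurableT_comp => //; exact: measurable_L1c.
- by move=> x _; rewrite lee_fin norm_mul_indic.
Qed.

Lemma nrm1_cut_convex f g t : 0 <= t -> t <= 1 ->
  nrm1 (cut A (t *: f + (1 - t) *: g)) <=
  t * nrm1 (cut A f) + (1 - t) * nrm1 (cut A g).
Proof.
move=> t0 t1; rewrite cutD !cutZ (le_trans (nrm1D _ _))// !nrm1Z.
by rewrite !ger0_norm// subr_ge0.
Qed.

Lemma cut_support f : L1K A (cut A f).
Proof. by apply: filterS (cutE f) => x -> nAx; rewrite indicE memNset// mulr0. Qed.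

Lemma cut_disjoint f K : A `&` K = set0 -> L1K K f -> cut A f = 0.
Proof.
move=> AK Kf; apply: L1c_ae; apply: filterS3 Kf (cutE f) (L1c_0E mu) => x fx -> ->.
rewrite indicE; have [Ax|nAx] := pselect (A x); last by rewrite memNset// mulr0.
rewrite fx ?mul0r// => Kx; suff: (A `&` K) x by rewrite AK.
by split.
Qed.

Lemma cut_id f : L1K A f -> cut A f = f.
Proof.
move=> Af; apply: L1c_ae; apply: filterS2 Af (cutE f) => x fx ->.
rewrite indicE; have [Ax|nAx] := pselect (A x); first by rewrite mem_set// mulr1.
by rewrite memNset// mulr0 fx.
Qed.

End measurable_cut.

Lemma cut_setD A B f : measurable (A : set (borel X)) ->
  measurable (B : set (borel X)) -> A `<=` B ->
  cut B f = cut A f + cut (B `\` A) f.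
Proof.
move=> mA mB AB; apply: L1c_ae; near=> x.
have -> : (cut A f + cut (B `\` A) f) x = cut A f x + cut (B `\` A) f x.
  by near: x; exact: L1c_addE.
have -> : cut A f x = f x * \1_A x by near: x; exact: cutE.
have -> : cut B f x = f x * \1_B x by near: x; exact: cutE.
have -> : cut (B `\` A) f x = f x * \1_(B `\` A) x.
  by near: x; apply: cutE; exact: measurableD.
rewrite -mulrDr; congr (_ * _); rewrite !indicE in_setD.
have [Ax|nAx] := pselect (A x).
  by rewrite !mem_set//= ?andbF ?addr0//; exact: AB.
by rewrite (memNset nAx) andbT add0r.
Unshelve. all: by end_near. Qed.

Lemma cut_sum (L : (set X)^nat) n f :
  (forall k, measurable (L k : set (borel X))) -> (forall k, L k `<=` L k.+1) ->
  L1K (L n) f -> f = \sum_(i < n.+1) cut (seqD L i) f.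
Proof.
move=> mL ndL /(cut_id (mL n)) {1}<-.
elim: n => [|n IH]; first by rewrite big_ord_recl big_ord0 addr0.
by rewrite big_ord_recr/= -IH; exact: cut_setD.
Qed.

End cut.

(** * Sigma-compact groups: convolution is continuous *)

(** Let v(n) >= 1 bound all w(i, j) with i, j <= n: then w(i, j) is at
    most v(max(i, j)), one factor of v(i) v(j), and the other factor is at
    least 1. *)
Lemma product_majorant (R : realDomainType) (w : nat -> nat -> R) :
  (forall i j, 0 <= w i j) ->
  exists2 v : nat -> R, (forall i, 1 <= v i) & forall i j, w i j <= v i * v j.
Proof.
move=> w0; pose v n := 1 + \sum_(i < n.+1) \sum_(j < n.+1) w i j.
have s0 n : 0 <= \sum_(i < n.+1) \sum_(j < n.+1) w i j.
  by apply: sumr_ge0 => i _; exact: sumr_ge0.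
have v1 n : 1 <= v n by rewrite lerDl.
have wv n i j : (i <= n)%N -> (j <= n)%N -> w i j <= v n.
  move=> iN jN; rewrite -ltnS in iN; rewrite -ltnS in jN.
  rewrite /v (bigD1 (Ordinal iN))//= (bigD1 (Ordinal jN))//=.
  rewrite addrCA -!addrA lerDl !addr_ge0//.
  - exact: sumr_ge0.
  - by apply: sumr_ge0 => k _; exact: sumr_ge0.
exists v => // i j; have [ij|ji] := leP i j.
  by rewrite (le_trans (wv j _ _ ij (leqnn _)))// ler_peMl// (le_trans ler01).
by rewrite (le_trans (wv i _ _ (leqnn _) (ltnW ji)))// ler_peMr// (le_trans ler01).
Qed.

(** Thickening the compact sets by a compact neighbourhood of 1 lets the
    interiors of the L(n) cover G; by compactness K is then inside one L(n). *)
Lemma sigma_compact_exhaustion (G : topologicalGroupType) :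
  locally_compact [set: G] -> sigma_compact G ->
  exists L : (set G)^nat, [/\ forall n, compact (L n),
    forall n, L n `<=` L n.+1 & forall K, compact K -> exists n, K `<=` L n].
Proof.
move=> lG [K [cK KG]]; have [V cV nV] := locally_compact_nbhs1 lG.
pose C n := \big[setU/set0]_(i < n.+1) K i.
have CS n m : (n <= m)%N -> C n `<=` C m.
  by move=> nm; apply: subset_bigsetU; rewrite ltnS.
exists (fun n => mulset (C n) V); split.
- by move=> n; apply: compact_mulset => //; apply: bigsetU_compact => i _.
- move=> n _ [x Cx [y Vy <-]]; apply: mulset_mem => //.
  exact: (CS n n.+1).
- move=> B /compact_near_coveringP cB.
  have : \forall n \near \oo, B `<=` mulset (C n) V.
    apply: cB => x _; have [m _ Kmx] : (\bigcup_n K n) x by rewrite KG.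
    exists (mulset [set x] V, [set n | (m <= n)%N]).
      by split; [exact: nbhs_mulset|exists m].
    move=> [_ n] /= [[z -> [y Vy <-]] mn]; apply: mulset_mem => //.
    apply: (CS m n mn).
    by rewrite /C -bigcup_mkord; exists m => /=.
  by move=> [n _ Bn]; exists n; apply: Bn => /=.
Qed.

Section convex_sums.
Context (R : realType) (E : lmodType R) (U : set E).
Hypothesis cU : forall f g (t : R), 0 <= t -> t <= 1 -> U f -> U g ->
  U (t *: f + (1 - t) *: g).
Hypothesis U0 : U 0.

(** The cone over a convex set is closed under addition. *)
Lemma cone_sum I (r : seq I) (c : I -> R) (h : I -> E) :
  (forall i, 0 <= c i) -> (forall i, exists2 u, U u & h i = c i *: u) ->
  exists2 u, U u & \sum_(i <- r) h i = (\sum_(i <- r) c i) *: u.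
Proof.
move=> c0 hc; elim: r => [|i r [u Uu IH]].
  by exists 0; rewrite // !big_nil scale0r.
have [w Uw hi] := hc i; rewrite !big_cons IH hi.
set s := \sum_(j <- r) c j; have s0 : 0 <= s by exact: sumr_ge0.
have [cs|cs] := eqVneq (c i + s) 0.
  exists 0; rewrite // cs scale0r.
  have ci0 : c i = 0 by apply/eqP; move/eqP: cs; rewrite paddr_eq0// => /andP[].
  by move: cs; rewrite ci0 add0r => ->; rewrite !scale0r addr0.
have cs0 : 0 < c i + s by rewrite lt0r cs addr_ge0.
exists ((c i / (c i + s)) *: w + (1 - c i / (c i + s)) *: u).
  apply: cU => //; first by rewrite divr_ge0// ltW.
  by rewrite ler_pdivrMr// mul1r lerDl.
rewrite scalerDr !scalerA; congr (_ *: _ + _ *: _); first by rewrite mulrC divfK.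
by rewrite mulrBr mulr1 mulrC divfK// addrC addKr.
Qed.

Lemma subconvex_sum I (r : seq I) (c : I -> R) (h : I -> E) :
  (forall i, 0 <= c i) -> (forall i, exists2 u, U u & h i = c i *: u) ->
  \sum_(i <- r) c i <= 1 -> U (\sum_(i <- r) h i).
Proof.
move=> c0 hc c1; have [u Uu ->] := cone_sum r c0 hc.
have := cU (sumr_ge0 _ (fun i _ => c0 i)) c1 Uu U0.
by rewrite scaler0 addr0.
Qed.

End convex_sums.

Section sufficiency.
Context (R : realType) (G : topologicalGroupType) (hG : hausdorff_space G)
  (lG : locally_compact [set: G]).
Variable mu : {measure set (borel G) -> \bar R}.
Hypothesis hmu : left_haar_measure mu.

Lemma convolution_suml I (r : seq I) (f : I -> L1c mu) g :
  convolution (\sum_(i <- r) f i) g = \sum_(i <- r) convolution (f i) g.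
Proof.
elim: r => [|i r IH]; last by rewrite !big_cons convolutionDl// IH.
by rewrite !big_nil -(scale0r (0 : L1c mu)) convolutionZl// !scale0r.
Qed.

Lemma convolution_sumr I (r : seq I) (f : I -> L1c mu) g :
  convolution g (\sum_(i <- r) f i) = \sum_(i <- r) convolution g (f i).
Proof.
elim: r => [|i r IH]; last by rewrite !big_cons convolutionDr// IH.
by rewrite !big_nil -(scale0r (0 : L1c mu)) convolutionZr// !scale0r.
Qed.

(** The neighbourhood V is a ball of the weighted norm sum_n v_n |f 1_(A_n)|,
    where A_n is the n-th layer [seqD L n]; f * g is then a sub-convex
    combination of elements of U indexed by pairs of layers. *)
Lemma convolution_continuous0 : sigma_compact G ->
  forall U : set (L1c mu), lcdlim_nbhs0 U -> exists2 V, lcdlim_nbhs0 V &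
    forall f g, V f -> V g -> U (convolution f g).
Proof.
move=> /(sigma_compact_exhaustion lG)[L [cL ndL exhL]] U.
move=> /lcdlim_nbhs0P[cU nU].
have mL n : measurable (L n : set (borel G)) by exact: borel_compact.
have mA n : measurable (seqD L n : set (borel G)).
  by case: n => [|n]; [exact: mL|exact: measurableD].
have U_0 : U 0.
  have [e e0 eU] := nU set0 (@compact0 _); apply: eU; last by rewrite nrm1_0.
  by apply: filterS (L1c_0E mu) => x.
have /choice[eps peps] k : exists e : R, 0 < e /\
    forall f : L1c mu, L1K (L k) f -> nrm1 f < e -> U f.
  by have [e e0 eU] := nU _ (cL k); exists e.
have /choice[k pk] (ij : nat * nat) : exists n, mulset (L ij.1) (L ij.2) `<=` L n.
  by apply: exhL; exact: compact_mulset.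
(* The factor 2 makes the norm of the normalised products at most eps / 2,
   hence strictly less than eps. *)
have [|v v1 vw] := @product_majorant R (fun i j => 2 / eps (k (i, j))).
  by move=> i j; rewrite divr_ge0// ltW//; have [] := peps (k (i, j)).
have v0 i : 0 < v i by rewrite (lt_le_trans ltr01).
pose V : set (L1c mu) := [set f | forall N : nat,
  \sum_(i < N) v i * nrm1 (cut (seqD L i) f) <= 1].
exists V.
  apply/lcdlim_nbhs0P; split.
    move=> f g t t0 t1 Vf Vg N.
    apply: (@le_trans _ _ (\sum_(i < N) (t * (v i * nrm1 (cut (seqD L i) f)) +
        (1 - t) * (v i * nrm1 (cut (seqD L i) g))))).
      apply: ler_sum => i _; rewrite !(mulrCA _ (v i)) -mulrDr.
      by rewrite ler_pM2l//; exact: nrm1_cut_convex.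
    rewrite big_split/= -!mulr_sumr.
    rewrite (@le_trans _ _ (t * 1 + (1 - t) * 1))//; last by lra.
    by apply: lerD; apply: ler_wpM2l; rewrite ?subr_ge0//; [exact: Vf|exact: Vg].
  (* A function supported by L n has no mass on the layers after the n-th. *)
  move=> K /exhL[n Kn]; pose S := \sum_(i < n.+1) v i.
  have S0 : 0 < S.
    by rewrite /S big_ord_recl ltr_pwDl// sumr_ge0// => i _; rewrite ltW.
  exists S^-1; first by rewrite invr_gt0.
  move=> f Kf fS N.
  have Lf : L1K (L n) f by apply: filterS Kf => x fx nLx; apply: fx => /Kn.
  have F0 i : 0 <= v i * nrm1 (cut (seqD L i) f).
    by rewrite mulr_ge0 ?nrm1_ge0// ltW.
  have Fn i : (n < i)%N -> v i * nrm1 (cut (seqD L i) f) = 0.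
    case: i => // i ni; rewrite (cut_disjoint (mA _) _ Lf) ?nrm1_0 ?mulr0//.
    apply/seteqP; split => // x [[_ nLx] Lnx]; apply: nLx.
    have : {homo L : a b / (a <= b)%N >-> a `<=` b}.
      by apply: homo_leq => [A x'|B A C|]; [by []|exact: subset_trans|exact: ndL].
    by move=> /(_ n i ni); exact.
  have Sle : \sum_(i < n.+1) v i * nrm1 (cut (seqD L i) f) <= 1.
    apply: (@le_trans _ _ (\sum_(i < n.+1) v i * nrm1 f)).
      by apply: ler_sum => i _; rewrite ler_pM2l// nrm1_cut.
    by rewrite -mulr_suml -ler_pdivlMl// mulr1 ltW.
  apply: le_trans Sle.
  rewrite -!(big_mkord xpredT (fun i => v i * nrm1 (cut (seqD L i) f))).
  have [Nn|nN] := leqP N n.+1.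
    by rewrite [leRHS](big_cat_nat (n := N))//= lerDl sumr_ge0.
  rewrite (big_cat_nat (n := n.+1))//=; last exact: ltnW.
  rewrite [X in _ + X]big_nat_cond [X in _ + X]big1 ?addr0// => i.
  by rewrite andbT => /andP[ni _]; exact: Fn.
move=> f g Vf Vg.
have [K cK Kf] := L1c_support f; have [K' cK' Kg] := L1c_support g.
have [N KN] := exhL _ (compactU cK cK').
have Lf : L1K (L N) f.
  by apply: filterS Kf => x fx nLx; apply: fx => Kx; apply: nLx; apply: KN; left.
have Lg : L1K (L N) g.
  by apply: filterS Kg => x fx nLx; apply: fx => Kx; apply: nLx; apply: KN; right.
rewrite (cut_sum mL ndL Lf) (cut_sum mL ndL Lg) convolution_suml.
under eq_bigr do rewrite convolution_sumr.
rewrite pair_bigA/=.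
pose c (p : 'I_N.+1 * 'I_N.+1) : R := v p.1 * nrm1 (cut (seqD L p.1) f) *
  (v p.2 * nrm1 (cut (seqD L p.2) g)).
apply: (subconvex_sum cU U_0 (c := c)).
- by move=> p; rewrite !mulr_ge0 ?nrm1_ge0// ltW.
- move=> [i j]; rewrite /c/=.
  set fi := cut _ f; set gj := cut _ g; set a := _ * _ * _.
  have ale : nrm1 (convolution fi gj) <= nrm1 fi * nrm1 gj by exact: nrm1_convolution.
  have aE : a = v i * v j * (nrm1 fi * nrm1 gj) by rewrite /a mulrACA.
  have seqDL n : seqD L n `<=` L n by case: n => // n x [].
  have supp : L1K (L (k (val i, val j))) (convolution fi gj).
    have : L1K (mulset (L i) (L j)) (convolution fi gj).
      apply: convolution_support => //.
        by apply: filterS (cut_support (mA i) f) => x fx nLx; apply: fx => /seqDL.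
      by apply: filterS (cut_support (mA j) g) => x fx nLx; apply: fx => /seqDL.
    by apply: filterS => x fx nLx; apply: fx => /(pk (val i, val j)).
  have [a0|a0] := eqVneq a 0.
    exists 0 => //; rewrite a0 scale0r; apply: nrm1_eq0.
    apply/eqP; rewrite eq_le nrm1_ge0 andbT (le_trans ale)//.
    move/eqP : a0; rewrite aE mulf_eq0 mulf_eq0 (gt_eqF (v0 i)) (gt_eqF (v0 j))/=.
    by move=> /eqP ->.
  have ap : 0 < a by rewrite lt0r a0 aE !mulr_ge0 ?nrm1_ge0// ltW.
  exists (a^-1 *: convolution fi gj); last by rewrite scalerA mulfV// scale1r.
  have [e0 eU] := peps (k (val i, val j)); apply: eU; first exact: L1KZ.
  rewrite nrm1Z gtr0_norm ?invr_gt0// mulrC ltr_pdivrMr//.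
  apply: (le_lt_trans ale); rewrite aE.
  have ff : 0 < nrm1 fi * nrm1 gj.
    by move: ap; rewrite aE pmulr_rgt0// mulr_gt0.
  rewrite mulrA ltr_pMl//.
  have := vw i j; rewrite ler_pdivrMr// [_ * eps _]mulrC => /(lt_le_trans _); apply.
  by rewrite ltr1n.
- have -> : \sum_(p : 'I_N.+1 * 'I_N.+1) c p =
    (\sum_(i < N.+1) v i * nrm1 (cut (seqD L i) f)) *
    (\sum_(j < N.+1) v j * nrm1 (cut (seqD L j) g)).
    by rewrite big_distrlr/= pair_bigA.
  by apply: mulr_ile1; rewrite ?sumr_ge0// => i _; rewrite mulr_ge0 ?nrm1_ge0// ltW.
Qed.

Theorem sigma_compact_convolution_continuous : sigma_compact G ->
  continuous (fun p : L1c mu * L1c mu => convolution p.1 p.2).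
Proof.
move=> sG; apply: (@bilinear_continuous _ _ mu (@convolution R G mu)).
- exact: convolutionDl.
- exact: convolutionDr.
- exact: convolutionZl.
- exact: convolutionZr.
- exact: convolution_continuous0.
Qed.

End sufficiency.

(** * Well-orders and product majorants *)

Definition strict_well_order (T : Type) (lt : T -> T -> Prop) :=
  [/\ forall x, ~ lt x x, forall x y z, lt x y -> lt y z -> lt x z,
      forall x y, [\/ lt x y, x = y | lt y x] &
      forall A : set T, A !=set0 ->
        exists2 m, A m & forall x, A x -> ~ lt x m].

Lemma strict_well_order_exists (T : eqType) :
  exists lt : T -> T -> Prop, strict_well_order lt.
Proof.
have [le wo_le] := wochoice.well_ordering_principle T.
have least (A : set T) : A !=set0 -> exists2 m, A m & forall x, A x -> le m x.
  move=> [x Ax]; have [|m [[+ mA] _]] := wo_le [pred x | `[< A x >]].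
    by exists x; apply/asboolP.
  move=> /asboolP Am; exists m => // y Ay.
  by apply: mA; apply/asboolP.
have anti x y : le x y -> le y x -> x = y.
  move=> xy yx; have [|m [_ um]] := wo_le [pred z | (z == x) || (z == y)].
    by exists x; rewrite inE eqxx.
  have xx : le x x.
    by have [m' -> /(_ x erefl)] := least [set x] (ex_intro _ x erefl).
  have yy : le y y.
    by have [m' -> /(_ y erefl)] := least [set y] (ex_intro _ y erefl).
  rewrite -(um x) ?(um y)//; split; rewrite ?inE ?eqxx ?orbT//.
    by move=> z; rewrite inE => /orP[] /eqP ->.
  by move=> z; rewrite inE => /orP[] /eqP ->.
have total x y : le x y \/ le y x.
  have [|m [->|->] mA] := least [set x; y]; first by exists x; left.
    by left; apply: mA; right.
  by right; apply: mA; left.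
have trans x y z : le x y -> le y z -> le x z.
  move=> xy yz; have [|m + mA] := least [set t | [\/ t = x, t = y | t = z]].
    by exists x; constructor 1.
  have mx := mA x (Or31 _ _ erefl); have my := mA y (Or32 _ _ erefl).
  have mz := mA z (Or33 _ _ erefl).
  case=> mE; rewrite {}mE in mx my mz => //; first by rewrite (anti _ _ xy mx).
  by rewrite -(anti _ _ yz my).
exists (fun x y => le x y /\ x <> y); split.
- by move=> x [_ /(_ erefl)].
- move=> x y z [xy nxy] [yz nyz]; split; first exact: trans yz.
  by move=> xz; rewrite -xz in yz; apply: nxy; exact: anti.
- move=> x y; have [->|/eqP xy] := eqVneq x y; first by constructor 2.
  have [?|?] := total x y; first by constructor 1.
  by constructor 3; split=> //; exact: nesym.
- move=> A /least[m Am mA]; exists m => // x /mA mx [xm nxm].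
  by apply: nxm; exact: anti.
Qed.

Section countable_initial_segments.
Context (T : choiceType) (lt : T -> T -> Prop) (N : set T).
Hypothesis wo_lt : strict_well_order lt.

(** This keeps the part of N of order type at most omega_1. If it were
    countable, the least element of N outside it would have all its predecessors
    in it, hence belong to it. *)
Lemma uncountable_countable_segments : ~ countable N ->
  ~ countable [set x | N x /\ countable (N `&` lt^~ x)].
Proof.
have [irr tr tri wf] := wo_lt.
set N' := [set x | _] => nN cN'.
have [NN'|/existsNP[x /not_implyP[Nx nN'x]]] := pselect (N `<=` N').
  by apply: nN; apply: sub_countable cN'; exact: subset_card_le.
have [|m [Nm nN'm] mmin] := wf (N `\` N'); first by exists x.
apply: nN'm; split => //; apply: sub_countable cN'; apply: subset_card_le.
by move=> y [Ny ym]; apply: contrapT => nN'y; exact: (mmin y).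
Qed.

(** In a subset of m + 2 elements the largest one has m + 1 predecessors, too many
    for an injection into the numbers below m. *)
Lemma finite_bounded_segments (A : set T) (e : T -> T -> nat) m :
  (forall i, A i -> {in A `&` lt^~ i &, injective (e i)}) ->
  (forall i j, A i -> A j -> lt j i -> (e i j < m)%N) -> finite_set A.
Proof.
have [irr tr tri wf] := wo_lt.
move=> einj em; apply: contrapT => /(infinite_set_fset m.+2)[B BA Bm].
pose ge x y := `[< x = y \/ lt y x >].
have ge_total : total ge.
  move=> x y; rewrite /ge; apply/orP.
  by have [xy|->|yx] := tri x y; [right|left|left]; apply/asboolP; tauto.
have ge_trans : transitive ge.
  move=> y x z /asboolP xy /asboolP yz; apply/asboolP.
  move: xy yz => [->//|yx] [<-|zy]; right => //; exact: tr zy yx.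
have := sort_sorted ge_total (enum_fset B).
have : perm_eq (sort ge (enum_fset B)) (enum_fset B) by rewrite perm_sort.
case: (sort ge (enum_fset B)) => [|i s] perm_s.
  by move/perm_size : perm_s Bm => /=; rewrite cardfE /= => <-.
rewrite /= => /(order_path_min ge_trans)/allP is_.
have us : uniq (i :: s) by rewrite (perm_uniq perm_s) fset_uniq.
have sA j : j \in i :: s -> A j.
  by rewrite (perm_mem perm_s) => jB; exact: BA.
have slt j : j \in s -> lt j i.
  move=> js; have /asboolP[ij|//] := is_ j js.
  by move: us; rewrite /= ij js.
have Ai : A i by apply: sA; rewrite mem_head.
have sAlt j : j \in s -> j \in A `&` lt^~ i.
  by move=> js; rewrite inE; split; [apply: sA; rewrite inE js orbT|exact: slt].
have ue : uniq (map (e i) s).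
  rewrite map_inj_in_uniq; first by case/andP: us.
  by move=> j k /sAlt js /sAlt ks; exact: einj.
have : (size (map (e i) s) <= size (iota 0 m))%N.
  apply: uniq_leq_size => // _ /mapP[j /sAlt + ->]; rewrite inE => -[Aj ji].
  by rewrite mem_iota add0n; exact: em.
rewrite size_map size_iota => sm.
have := perm_size perm_s; rewrite /= => sB.
by move: Bm; rewrite -sB ltnS ltnNge sm.
Qed.

(** On the set where a and b are at least 1 / (n + 1) the numberings e_i are
    bounded by (n + 1)^2, so this set is finite; countably many such sets
    cover N. *)
Lemma no_product_majorant (R : archiRealFieldType) (e : T -> T -> nat)
    (a b : T -> R) :
  (forall i, N i -> {in N `&` lt^~ i &, injective (e i)}) ->
  (forall i, N i -> 0 < a i /\ 0 < b i) ->
  (forall i j, N i -> N j -> lt j i -> (e i j).+1%:R * (a i * b j) <= 1) ->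
  countable N.
Proof.
move=> einj ab0 eab.
pose A n := [set i | N i /\ (n.+1%:R^-1 <= a i /\ n.+1%:R^-1 <= b i)].
have : N `<=` \bigcup_n A n.
  move=> i Ni; have [ai bi] := ab0 i Ni.
  pose n := maxn (Num.truncn (a i)^-1) (Num.truncn (b i)^-1).
  exists n => //; split=> //; split.
    rewrite invf_ple ?posrE// (le_trans (ltW (truncnS_gt _)))// ler_nat ltnS.
    exact: leq_maxl.
  rewrite invf_ple ?posrE// (le_trans (ltW (truncnS_gt _)))// ler_nat ltnS.
  exact: leq_maxr.
move=> /subset_card_le/sub_countable; apply; apply: bigcup_countable => // n _.
apply: finite_set_countable.
apply: (@finite_bounded_segments _ e (n.+1 * n.+1)%N).
  move=> i [Ni _] j k; rewrite !inE => -[[Nj _] ji] [[Nk _] ki].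
  by apply: einj => //; rewrite inE.
move=> i j [Ni [ai _]] [Nj [_ bj]] ji.
rewrite -(ler_nat R) natrM -[leRHS]mul1r -ler_pdivrMr ?mulr_gt0//.
apply: le_trans (eab i j Ni Nj ji); rewrite ler_pM2l// invfM.
by apply: ler_pM; rewrite ?invr_ge0.
Qed.

End countable_initial_segments.

(** * Generated subgroups *)

Section generated_subgroup.
Context (G : topologicalGroupType).
Implicit Types (x y : G) (S H : set G).

Definition is_subgroup H := H 1%g /\ forall x y, H x -> H y -> H (x * y^-1)%g.

Definition gen S := [set x | forall H, is_subgroup H -> S `<=` H -> H x].

Lemma is_subgroupV H x : is_subgroup H -> H x -> H (x^-1)%g.
Proof. by move=> [H1 HM] Hx; rewrite -[(x^-1)%g]mul1g; exact: HM. Qed.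

Lemma is_subgroupM H x y : is_subgroup H -> H x -> H y -> H (x * y)%g.
Proof.
move=> sH Hx Hy; rewrite -[y]invgK; apply: sH.2 => //; exact: is_subgroupV.
Qed.

Lemma is_subgroupMr H x y : is_subgroup H -> H y -> H (x * y)%g -> H x.
Proof. by move=> sH Hy Hxy; rewrite -(mulgK y x); exact: sH.2. Qed.

Lemma is_subgroupMl H x y : is_subgroup H -> H x -> H (x * y)%g -> H y.
Proof.
move=> sH Hx Hxy; rewrite -(mulKg x y); apply: is_subgroupM => //.
exact: is_subgroupV.
Qed.

Lemma gen_subgroup S : is_subgroup (gen S).
Proof.
split=> [H sH _|x y Sx Sy H sH SH]; first by case: sH.
by apply: sH.2; [exact: Sx|exact: Sy].
Qed.

Lemma sub_gen S : S `<=` gen S.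
Proof. by move=> x Sx H _; exact. Qed.

Lemma gen_min S H : is_subgroup H -> S `<=` H -> gen S `<=` H.
Proof. by move=> sH SH x; exact. Qed.

Lemma gen_mono S S' : S `<=` S' -> gen S `<=` gen S'.
Proof.
move=> SS'; apply: gen_min; first exact: gen_subgroup.
by apply: subset_trans SS' _; exact: sub_gen.
Qed.

(** The sets D(0) = {1} and D(n + 1) = B B^-1, where B = D(n) u K(n) u {1}, are
    compact and increasing, and their union is a subgroup containing all K(n). *)
Lemma sigma_compact_generated (K : (set G)^nat) : (forall n, compact (K n)) ->
  gen (\bigcup_n K n) = setT -> sigma_compact G.
Proof.
move=> cK genK.
pose B n D := D `|` K n `|` [set 1%g] : set G.
pose step n D := mulset (B n D) ((fun x : G => (x^-1)%g) @` B n D).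
pose D := fix D n := if n is m.+1 then step m (D m) else [set 1%g].
have DS n : B n (D n) `<=` D n.+1.
  move=> x Bx; rewrite -[x]mulg1; apply: mulset_mem => //.
  by exists 1%g; [right|rewrite invg1].
have D_S n : D n `<=` D n.+1 by move=> x Dx; apply: DS; left; left.
have Dhomo : {homo D : a b / (a <= b)%N >-> a `<=` b}.
  by apply: homo_leq => [A x|A' A A'' |]; [by []|exact: subset_trans|exact: D_S].
exists D; split.
  elim=> [|n cD]; first exact: compact_set1.
  have cB : compact (B n (D n)).
    by apply: compactU; [exact: compactU|exact: compact_set1].
  by apply: compact_mulset => //; apply: compact_image => //; exact: invg_continuous.
rewrite -subTset -genK; apply: gen_min.
- split; first by exists 0%N.
  move=> x y [n _ Dx] [m _ Dy].
  exists (maxn n m).+1 => //; apply: mulset_mem.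
    by left; left; apply: Dhomo Dx; exact: leq_maxl.
  by exists y => //; left; left; apply: Dhomo Dy; exact: leq_maxr.
- by move=> x [n _ Kx]; exists n.+1 => //; apply: DS; left; right.
Qed.

Lemma sigma_compact_gen_countable V S : compact V -> countable S ->
  gen (V `|` S) = setT -> sigma_compact G.
Proof.
move=> cV /countable_injP[f injf] genVS.
apply: (@sigma_compact_generated (fun n => V `|` (S `&` f @^-1` [set n]))).
  move=> n; apply: compactU => //.
  have [->|/set0P[x [Sx fx]]] := eqVneq (S `&` f @^-1` [set n]) set0.
    exact: compact0.
  rewrite (_ : _ `&` _ = [set x]); first exact: compact_set1.
  apply/seteqP; split => [y [Sy fy]|y ->//]; apply: injf; rewrite ?inE//.
  by rewrite fy fx.
rewrite -subTset -genVS; apply: gen_mono => x [Vx|Sx].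
  by exists 0%N => //; left.
by exists (f x) => //; right.
Qed.

End generated_subgroup.

(** * Blocks of new elements *)

Section new_elements.
Context (G : topologicalGroupType) (lt : G -> G -> Prop).
Hypothesis wo_lt : strict_well_order lt.
Variable V : set G.

Definition hull x := gen (V `|` lt^~ x).

(** The greedy choice, along the order, of generators of G over V. *)
Definition new_elements := [set x | ~ hull x x].

(** Well-founded induction: an element that is not new is generated by V and
    earlier elements. *)
Lemma gen_new_elements : gen (V `|` new_elements) = setT.
Proof.
have [irr tr tri wf] := wo_lt.
rewrite -subTset => x _; apply: contrapT => nx.
have [|m nm mmin] := wf (~` gen (V `|` new_elements)); first by exists x.
apply: nm; have [hm|nhm] := pselect (hull m m); last first.
  by apply: sub_gen; right.
apply: (gen_min (gen_subgroup _) _ hm) => y [Vy|ym]; first by apply: sub_gen; left.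
by apply: contrapT => ny; exact: (mmin y).
Qed.

Lemma hullV x : V `<=` hull x.
Proof. by move=> y Vy; apply: sub_gen; left. Qed.

Lemma hull_lt x y : lt y x -> hull x y.
Proof. by move=> yx; apply: sub_gen; right. Qed.

Lemma hull_subgroup x : is_subgroup (hull x).
Proof. exact: gen_subgroup. Qed.

Definition block i j := mulset (mulset [set i] V) [set j].

Lemma hull_block x i j : hull x i -> hull x j -> block i j `<=` hull x.
Proof.
move=> hi hj _ [_ [_ -> [v Vv <-]] [_ -> <-]].
apply: (is_subgroupM (hull_subgroup x)) => //.
by apply: (is_subgroupM (hull_subgroup x)) => //; exact: hullV.
Qed.

(** Otherwise s, and then t = k v l, lie in the hull of k, which contains v and
    l but, k being new, does not contain k. *)
Let block_le i j k l s t : new_elements k -> lt j i -> lt l k ->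
  block i j s -> block k l t -> hull k (s^-1 * t)%g -> ~ lt i k.
Proof.
have [irr tr tri wf] := wo_lt; have sH := hull_subgroup k.
move=> nk ji lk sij [_ [_ -> [v Vv <-]] [_ -> tE]] st ik.
have hs : hull k s.
  by apply: hull_block sij; apply: hull_lt => //; exact: tr ik.
have ht : hull k t by rewrite -(mulVKg s t); exact: (is_subgroupM sH).
apply: nk; apply: (is_subgroupMr sH (hullV Vv)).
by apply: (is_subgroupMr sH (hull_lt lk)); rewrite tE.
Qed.

Lemma hull_quotient x s t z : mulset [set z] V s -> mulset [set z] V t ->
  hull x (s^-1 * t)%g.
Proof.
move=> [_ -> [h Vh <-]] [_ -> [h' Vh' <-]]; rewrite invgM -mulgA mulKg.
have sH := hull_subgroup x.
by apply: (is_subgroupM sH); [apply: (is_subgroupV sH)|]; exact: hullV.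
Qed.

(** No translate z V meets two blocks. The larger of i and k would lie in its own
    hull by [block_le]; once i = k, so would the larger of j and l. *)
Lemma block_unique z i j k l : new_elements i -> new_elements j ->
  new_elements k -> new_elements l -> lt j i -> lt l k ->
  block i j `&` mulset [set z] V !=set0 -> block k l `&` mulset [set z] V !=set0 ->
  i = k /\ j = l.
Proof.
have [irr tr tri wf] := wo_lt.
move=> ni nj nk nl ji lk [s [sij zs]] [t [tkl zt]].
have ik : i = k.
  have [ik|//|ki] := tri i k.
    by case: (block_le nk ji lk sij tkl (hull_quotient zs zt)).
  by case: (block_le ni lk ji tkl sij (hull_quotient zt zs)).
split => //; subst k.
have key x y (v w : G) : V v -> V w -> new_elements y ->
    hull y ((i * v * x)^-1 * (i * w * y))%g -> ~ lt x y.
  move=> Vv Vw ny hq xy; apply: ny; have sH := hull_subgroup y.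
  apply: (is_subgroupMl sH (hullV Vw)).
  have hvx : hull y (v * x)%g.
    by apply: (is_subgroupM sH); [exact: hullV|exact: hull_lt].
  have -> : (w * y = (v * x) * ((i * v * x)^-1 * (i * w * y)))%g.
    by rewrite !invgM -!mulgA mulKg mulVKg mulVKg.
  exact: (is_subgroupM sH).
case: sij tkl => _ [_ -> [v Vv <-]] [_ -> sE] [_ [_ -> [w Vw <-]] [_ -> tE]].
have [jl|//|lj] := tri j l.
  by case: (key j l v w Vv Vw nl _ jl); rewrite sE tE; exact: hull_quotient zs zt.
by case: (key l j w v Vw Vv nj _ lj); rewrite sE tE; exact: hull_quotient zt zs.
Qed.

(** By [block_unique] every point has a neighbourhood z V on which the values
    e i j of the blocks that it meets are bounded; compactness makes the bound
    uniform on K. *)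
Lemma blocks_locally_finite (e : G -> G -> nat) (K : set G) : compact K ->
  nbhs (1%g : G) V ->
  exists M, forall i j, new_elements i -> new_elements j -> lt j i ->
    block i j `&` K !=set0 -> (e i j < M)%N.
Proof.
move=> /compact_near_coveringP cK nV.
have : \forall M \near \oo, K `<=` (fun z => forall i j, new_elements i ->
    new_elements j -> lt j i -> block i j z -> (e i j < M)%N).
  apply: cK => z _.
  have [m mP] : exists m, forall i j, new_elements i -> new_elements j -> lt j i ->
      block i j `&` mulset [set z] V !=set0 -> (e i j < m)%N.
    have [[i [j [ni nj ji zij]]]|none] := pselect (exists i j, [/\ new_elements i,
        new_elements j, lt j i & block i j `&` mulset [set z] V !=set0]).
      exists (e i j).+1 => k l nk nl lk zkl.
      by have [-> ->] := block_unique nk nl ni nj lk ji zkl zij.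
    by exists 0%N => i j ni nj ji zij; exfalso; apply: none; exists i, j.
  exists (mulset [set z] V, [set n | (m <= n)%N]).
    by split; [exact: nbhs_mulset|exists m].
  move=> [z' n] /= [zz' mn] i j ni nj ji bz'.
  by apply: leq_trans mn; apply: mP => //; exists z'.
move=> [M _ KM]; exists M => i j ni nj ji [z [bz Kz]].
exact: (KM M (leqnn M) z Kz i j).
Qed.

End new_elements.

(** * Continuity of convolution forces sigma-compactness *)

Section necessity.
Context (R : realType) (G : topologicalGroupType) (hG : hausdorff_space G)
  (lG : locally_compact [set: G]).
Variable mu : {measure set (borel G) -> \bar R}.
Hypothesis hmu : left_haar_measure mu.

Lemma L1c_indicator (A : set G) : compact A -> exists f : L1c mu,
  [/\ L1K A f, {ae mu, forall x, 0 <= f x} & (nrm1 f)%:E = mu A].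
Proof.
move=> cA; have mA := borel_compact hG cA.
have m1A : measurable_fun setT (\1_A : borel G -> R) by exact: measurable_indic.
have iA : (\int[mu]_x `|(\1_A x : R)|%:E = mu A)%E.
  under eq_integral do rewrite ger0_norm//.
  by rewrite integral_indic// setIT.
have [||f fE Af] := @L1c_exists R G mu \1_A A _ cA.
- apply/integrableP; split; first exact/measurable_EFinP.
  by rewrite iA; exact: (radon_compact_fin (haar_radon hmu)).
- by apply: aeW => x nAx; rewrite indicE memNset.
exists f; split => //; last by rewrite (nrm1_ae m1A fE).
by apply: filterS fE => x ->.
Qed.

(** B absorbs the indicator function of A, and A has positive measure. *)
Lemma small_bump (B : set (L1c mu)) (A : set G) (x : G) : lcdlim_nbhs0 B ->
  compact A -> nbhs x A -> exists f : L1c mu,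
  [/\ B f, L1K A f, {ae mu, forall x, 0 <= f x} & 0 < nrm1 f].
Proof.
move=> BB cA nA; have [f [Af f0 fA]] := L1c_indicator cA.
have [r r0 Brf] := lcdlim_nbhs0_absorb f BB.
exists (r *: f); split => //.
- by rewrite L1c_valZ; exact: L1KZ.
- by apply: filterS2 f0 (L1c_scaleE r f) => y fy ->; rewrite mulr_ge0// ltW.
rewrite nrm1Z gtr0_norm// mulr_gt0// -lte_fin fA.
exact: (haar_nbhs_gt0 hG hmu (borel_compact hG cA) nA).
Qed.

(** Only blocks that meet the compact set K constrain functions supported by K,
    and on them the weights are bounded. *)
Lemma weighted_nbhs0 (lt : G -> G -> Prop) (V : set G) (e : G -> G -> nat) :
  strict_well_order lt -> compact V -> nbhs (1%g : G) V ->
  lcdlim_nbhs0 [set h : L1c mu | forall i j, new_elements lt V i ->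
    new_elements lt V j -> lt j i ->
    (e i j).+1%:R * nrm1 (cut (block V i j) h) <= 1].
Proof.
move=> wo cV nV; have mblock i j : measurable (block V i j : set (borel G)).
  apply: (borel_compact hG); apply: compact_mulset; last exact: compact_set1.
  by apply: compact_mulset => //; exact: compact_set1.
apply/lcdlim_nbhs0P; split.
  move=> f g t t0 t1 Uf Ug i j ni nj ji.
  apply: (@le_trans _ _ (t * ((e i j).+1%:R * nrm1 (cut (block V i j) f)) +
      (1 - t) * ((e i j).+1%:R * nrm1 (cut (block V i j) g)))).
    rewrite !(mulrCA _ (e i j).+1%:R) -mulrDr ler_pM2l//.
    exact: nrm1_cut_convex.
  rewrite (@le_trans _ _ (t * 1 + (1 - t) * 1))//; last by lra.
  by apply: lerD; apply: ler_wpM2l; rewrite ?subr_ge0//; [exact: Uf|exact: Ug].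
move=> K cK; have [M MP] := blocks_locally_finite wo e cK nV.
exists M.+1%:R^-1; first by rewrite invr_gt0.
move=> f Kf fM i j ni nj ji.
have [/(cut_disjoint (mblock i j))/(_ Kf) ->|/set0P bK] :=
  eqVneq (block V i j `&` K) set0.
  by rewrite nrm1_0 mulr0.
have eM := MP i j ni nj ji bK.
rewrite (@le_trans _ _ (M.+1%:R * M.+1%:R^-1))//; last by rewrite divff.
apply: ler_pM; rewrite ?nrm1_ge0//; first by rewrite ler_nat ltnW.
by rewrite (le_trans (nrm1_cut (mblock i j) f))// ltW.
Qed.

Lemma convolution_nbhs0 (U : set (L1c mu)) :
  continuous (fun p : L1c mu * L1c mu => convolution p.1 p.2) ->
  lcdlim_nbhs0 U -> exists V1 V2 : set (L1c mu), [/\ lcdlim_nbhs0 V1,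
    lcdlim_nbhs0 V2 & forall f g, V1 f -> V2 g -> U (convolution f g)].
Proof.
move=> cc BU; have := cc (0, 0) U; rewrite /=.
have -> : convolution (0 : L1c mu) 0 = 0.
  by rewrite -(scale0r (0 : L1c mu)) convolutionZl// !scale0r.
have nU : nbhs (0 : L1c mu) U by apply/nbhs0_L1cP; exists U.
move=> /(_ nU) [[A B] /= [/nbhs0_L1cP[V1 BV1 V1A] /nbhs0_L1cP[V2 BV2 V2B]] AB].
exists V1, V2; split => // f g Vf Vg.
by apply: (AB (f, g)); split; [exact: V1A|exact: V2B].
Qed.

(** The bumps F i and H j are supported by i V0 and V0 j, so their convolution
    is supported by the block i V j, where V = V0 V0. *)
Theorem convolution_continuous_sigma_compact :
  continuous (fun p : L1c mu * L1c mu => convolution p.1 p.2) -> sigma_compact G.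
Proof.
move=> cc; apply: contrapT => nsc.
have [lt wo] := strict_well_order_exists G.
have [V0 cV0 nV0] := locally_compact_nbhs1 lG.
have V01 : V0 1%g by exact: nbhs_singleton.
pose V := mulset V0 V0; have cV : compact V by exact: compact_mulset.
have nV : nbhs (1%g : G) V.
  by apply: filterS nV0 => x Vx; rewrite -[x]mulg1; exact: mulset_mem.
pose N := new_elements lt V.
have ncN : ~ countable N.
  move=> cN; apply: nsc; apply: (sigma_compact_gen_countable cV cN).
  exact: gen_new_elements.
apply: (uncountable_countable_segments wo ncN).
have /choice[e eP] (i : G) : exists f : G -> nat, countable (N `&` lt^~ i) ->
    {in N `&` lt^~ i &, injective f}.
  have [/countable_injP[f injf]|nc] := pselect (countable (N `&` lt^~ i)).
    by exists f.
  by exists (fun=> 0%N).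
have [V1 [V2 [BV1 BV2 V12]]] := convolution_nbhs0 cc (weighted_nbhs0 e wo cV nV).
have /choice[F FP] (i : G) : exists f : L1c mu, [/\ V1 f,
    L1K (mulset [set i] V0) f, {ae mu, forall x, 0 <= f x} & 0 < nrm1 f].
  apply: (small_bump (x := i) BV1); last exact: nbhs_mulset.
  by apply: compact_mulset => //; exact: compact_set1.
have /choice[H HP] (j : G) : exists f : L1c mu, [/\ V2 f,
    L1K (mulset V0 [set j]) f, {ae mu, forall x, 0 <= f x} & 0 < nrm1 f].
  apply: (small_bump (x := j) BV2).
    by apply: compact_mulset => //; exact: compact_set1.
  have : nbhs j ((fun y => (y * j)%g) @` V0) by apply: nbhs_mulgr; rewrite mulgV.
  by apply: filterS => _ [y Vy <-]; exact: mulset_mem.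
apply: (@no_product_majorant _ lt _ wo R e
  (fun i => nrm1 (F i)) (fun j => nrm1 (H j))).
- move=> i [Ni ci] j k; rewrite !inE => -[[Nj _] ji] [[Nk _] ki].
  by apply: (eP i ci); rewrite inE.
- by move=> i _; have [_ _ _ ?] := FP i; have [_ _ _ ?] := HP i.
move=> i j [Ni _] [Nj _] ji.
have [V1F KF F0 _] := FP i; have [V2H KH H0 _] := HP j.
have := V12 _ _ V1F V2H i j Ni Nj ji.
rewrite cut_id ?(nrm1_convolution_ge0 hG lG hmu F0 H0)//.
- apply: (borel_compact hG); apply: compact_mulset; last exact: compact_set1.
  by apply: compact_mulset => //; exact: compact_set1.
- have := convolution_support hG lG hmu (compact_mulset (@compact_set1 G i) cV0)
    (compact_mulset cV0 (@compact_set1 G j)) KF KH.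
  apply: filterS => x fx nx; apply: fx => 
    -[_ [_ -> [v Vv <-]] [_ [w Vw [_ -> <-]] xE]].
  apply: nx; rewrite -xE !mulgA; apply: mulset_mem => //.
  by rewrite -mulgA; apply: mulset_mem => //; exact: mulset_mem.
Qed.

End necessity.

Theorem corollary4p6 (R : realType) (G : topologicalGroupType)
    (hausdorff_G : hausdorff_space G)
    (locally_compact_G : locally_compact [set: G])
    (mu : {measure set (borel G) -> \bar R}) (haar_mu : left_haar_measure mu) :
  continuous (fun p : L1c mu * L1c mu => convolution p.1 p.2) <->
  sigma_compact G.
Proof.
split; first exact: convolution_continuous_sigma_compact.
exact: sigma_compact_convolution_continuous.
Qed.
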